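(* Let $0<p<\infty$, let $w,v\in A_\infty(\mathbb{R}^{n_1}\times\mathbb{R}^{n_2})$, and let $f$ be a complex-valued function on $\mathbb{R}^n=\mathbb{R}^{n_1}\times\mathbb{R}^{n_2}$. Then $f$ is in $L^1_{loc}(v)$ and satisfies $$\sup_{R\in\mathcal{R}}\Big(\frac1{w(R)}\int_R|f(x)-f_{v,R}|^p\,w(x)\,dx\Big)^{1/p}<\infty$$ if and only if $f$ is in $bmo$. In such a case, $$\|f\|_{bmo}\approx\sup_{R\in\mathcal{R}}\Big(\frac1{w(R)}\int_R|f(x)-f_{v,R}|^p\,w(x)\,dx\Big)^{1/p},$$ with implicit constants independent of $f$.
   Context: $\mathcal{R}$ is the collection of all rectangles $R=Q_1\times Q_2$ with $Q_1\subset\mathbb{R}^{n_1}$ and $Q_2\subset\mathbb{R}^{n_2}$ cubes with sides parallel to the axes. For $1<p<\infty$, $A_p(\mathbb{R}^{n_1}\times\mathbb{R}^{n_2})$ is the set of non-negative $w$, integrable over every $R\in\mathcal{R}$, with $\sup_{R\in\mathcal{R}}\big(\frac1{|R|}\int_R w\,dx\big)\big(\frac1{|R|}\int_R w^{-p'/p}\,dx\big)^{p/p'}<\infty$, $p'=p/(p-1)$; $A_\infty(\mathbb{R}^{n_1}\times\mathbb{R}^{n_2})=\bigcup_{1<p<\infty}A_p(\mathbb{R}^{n_1}\times\mathbb{R}^{n_2})$. $w(R)=\int_Rw\,dx$ and $f_{v,R}=\frac1{v(R)}\int_Rf(x)v(x)\,dx$. $L^1_{loc}(v)$ is the set of measurable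 $f$ with $\int_R|f|v\,dx<\infty$ for all $R\in\mathcal{R}$. $bmo$ is the set of locally integrable $f$ (modulo constants) with $\|f\|_{bmo}=\sup_{R\in\mathcal{R}}\frac1{|R|}\int_R|f(x)-f_R|\,dx<\infty$, $f_R=\frac1{|R|}\int_Rf\,dx$. $A\approx B$ means that each quantity is bounded by a constant multiple of the other. *)

(* Defs.v *)
From HB Require Import structures.
From mathcomp Require Import all_boot all_order all_algebra.
From mathcomp Require Import complex.
From mathcomp Require Import all_classical all_reals all_analysis.

Set Implicit Arguments.
Unset Strict Implicit.
Unset Printing Implicit Defensive.
Import Order.TTheory GRing.Theory Num.Theory ComplexField.Normc.

Local Open Scope classical_set_scope.
Local Open Scope ring_scope.
Local Open Scope complex_scope.

(* Tuples carry the product (Borel) sigma-algebra. *)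
Notation euclid R n := (n.-tuple (measurableTypeR R)).

Section cons_measure.
Context (R : realType) (n : nat).
Variable m : {sigma_finite_measure set (euclid R n) -> \bar R}.

Let lam : {sigma_finite_measure set (measurableTypeR R) -> \bar R} :=
  @lebesgue_measure R.

Definition tcons (x : measurableTypeR R * euclid R n) : euclid R n.+1 :=
  [tuple of x.1 :: x.2].

Lemma measurable_tcons : measurable_fun setT tcons.
Proof.
exact: (measurable_cons (measurable_fst : measurable_fun setT _)
                        (measurable_snd : measurable_fun setT _)).
Qed.

Definition cons_measure : set (euclid R n.+1) -> \bar R :=
  pushforward (lam \x m)%E tcons.

Let cons_measure0 : cons_measure set0 = 0%E.
Proof. by rewrite /cons_measure/pushforward preimage_set0 measure0. Qed.

Let cons_measure_ge0 A : (0 <= cons_measure A)%E.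
Proof. exact: (measure_ge0 (lam \x m)%E). Qed.

Let cons_measure_sigma_additive : semi_sigma_additive cons_measure.
Proof.
exact: (@measure_semi_sigma_additive _ _ _
  (measure_function_pushforward__canonical__measure_function_Measure
     (lam \x m)%E measurable_tcons)).
Qed.

HB.instance Definition _ := isMeasure.Build _ _ _ cons_measure
  cons_measure0 cons_measure_ge0 cons_measure_sigma_additive.

Let cons_measure_sigma_finite : sigma_finite setT cons_measure.
Proof.
have /sigma_finiteP[F [TF ndF Foo]] := sigma_finiteT lam.
have /sigma_finiteP[G [TG ndG Goo]] := sigma_finiteT m.
pose u (x : euclid R n.+1) : measurableTypeR R * euclid R n :=
  (thead x, [tuple of behead x]).
have uK : cancel tcons u.
  by move=> [a b]; rewrite /u/= theadE; congr pair; exact/val_inj.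
have mu_ : measurable_fun setT u.
  by apply/measurable_fun_pair; [exact: measurable_tnth|exact: measurable_behead].
exists (fun k => u @^-1` (F k `*` G k)).
  rewrite -preimage_bigcup; apply/esym; rewrite -subTset => x _ /=.
  have : [set: measurableTypeR R] (u x).1 by [].
  rewrite TF => -[i _ Fi].
  have : [set: euclid R n] (u x).2 by [].
  rewrite TG => -[j _ Gj].
  exists (maxn i j) => //; split.
    by move: Fi; exact/subsetPset/ndF/leq_maxl.
  by move: Gj; exact/subsetPset/ndG/leq_maxr.
move=> k; have [mF Fk] := Foo k; have [mG Gk] := Goo k; split.
  by rewrite -[X in measurable X]setTI; apply: mu_ => //; exact: measurableX.
rewrite /cons_measure /pushforward.
have -> : tcons @^-1` (u @^-1` (F k `*` G k)) = F k `*` G k.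
  by rewrite -comp_preimage (_ : u \o tcons = id)//; exact/funext.
by rewrite product_measure1E// lte_mul_pinfty// ge0_fin_numE.
Qed.

HB.instance Definition _ :=
  Measure_isSigmaFinite.Build _ _ _ cons_measure cons_measure_sigma_finite.

End cons_measure.

Fixpoint borel_lebesgue (R : realType) (n : nat) :
    {sigma_finite_measure set (euclid R n) -> \bar R} :=
  match n with
  | 0 => dirac ([tuple] : euclid R 0)
  | k.+1 => cons_measure (borel_lebesgue R k)
  end.

Definition borel_lebesgue2 (R : realType) (n1 n2 : nat) :
    {measure set (euclid R n1 * euclid R n2) -> \bar R} :=
  (borel_lebesgue R n1 \x borel_lebesgue R n2)%E.

(* R^n1 * R^n2, where measurable means Lebesgue (not just Borel) measurable. *)
Definition euclid2 (R : realType) (n1 n2 : nat) :=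
  caratheodory_type (borel_lebesgue2 R n1 n2)^*%mu.
HB.instance Definition _ (R : realType) (n1 n2 : nat) :=
  Measurable.on (euclid2 R n1 n2).

Definition lebesgue2 (R : realType) (n1 n2 : nat) :
    {measure set (euclid2 R n1 n2) -> \bar R} :=
  @completed_measure_extension _ _ _ (borel_lebesgue2 R n1 n2).

Definition cube (R : realType) (n : nat) : set (set (euclid R n)) :=
  [set Q | exists (a : euclid R n) (l : R), 0 < l /\
    Q = [set x | forall i : 'I_n, tnth a i <= tnth x i <= tnth a i + l]].
Arguments cube : clear implicits.

Definition rectangle (R : realType) (n1 n2 : nat) : set (set (euclid2 R n1 n2)) :=
  [set Q1 `*` Q2 | Q1 in cube R n1 & Q2 in cube R n2].
Arguments rectangle : clear implicits.

Section weights.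
Context (R : realType) (n1 n2 : nat).
Local Notation X := (euclid2 R n1 n2).
Local Notation mu := (lebesgue2 R n1 n2).
Local Open Scope ereal_scope.
Implicit Types (w v : X -> R) (f : X -> R[i]) (Q : set X) (p : R).

(* The value of w^(-p'/p) is taken in [0, +oo], with +oo where w vanishes.
   Weights that vanish almost everywhere are ruled out explicitly: for them the
   product below has the form 0 * +oo, which is 0 in \bar R, and w(Q) = 0. *)
Definition Ap p w : Prop :=
  let p' := (p / (p - 1))%R in
  [/\ forall x, (0 <= w x)%R,
      ~ {ae mu, forall x, w x = 0%R},
      forall Q, rectangle R n1 n2 Q -> mu.-integrable Q (EFin \o w) &
      ereal_sup
        [set ((mu Q)^-1 * \int[mu]_(x in Q) (w x)%:E) *
             ((mu Q)^-1 * \int[mu]_(x in Q) ((w x)%:E `^ (p' / p)%R)^-1)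
               `^ (p / p')%R | Q in rectangle R n1 n2] < +oo].

Definition Ainfty w : Prop := exists2 p, (1 < p)%R & Ap p w.

Definition wmeas w Q : \bar R := \int[mu]_(x in Q) (w x)%:E.

Definition cmeasurable f : Prop :=
  measurable_fun [set: X] (fun x => complex.Re (f x)) /\
  measurable_fun [set: X] (fun x => complex.Im (f x)).

Definition L1loc v f : Prop :=
  cmeasurable f /\
  forall Q, rectangle R n1 n2 Q ->
    \int[mu]_(x in Q) (normc (f x) * v x)%:E < +oo.

Definition cintegral Q f : R[i] :=
  (\int[mu]_(x in Q) complex.Re (f x) +i* \int[mu]_(x in Q) complex.Im (f x))%R.

Definition wmean v f Q : R[i] :=
  ((fine (wmeas v Q))^-1%:C * cintegral Q (fun x => f x * (v x)%:C))%R.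

Definition average f Q : R[i] := ((fine (mu Q))^-1%:C * cintegral Q f)%R.

(* A seminorm on functions; functions are not identified modulo constants. *)
Definition bmo_norm f : \bar R :=
  ereal_sup [set (mu Q)^-1 * \int[mu]_(x in Q) (normc (f x - average f Q))%:E
            | Q in rectangle R n1 n2].

Definition bmo f : Prop :=
  [/\ cmeasurable f,
      forall Q, rectangle R n1 n2 Q ->
        \int[mu]_(x in Q) (normc (f x))%:E < +oo &
      bmo_norm f < +oo].

Definition weighted_osc p w v f : \bar R :=
  ereal_sup
    [set ((wmeas w Q)^-1 *
          \int[mu]_(x in Q) (normc (f x - wmean v f Q) `^ p * w x)%:E) `^ (p^-1)%R
    | Q in rectangle R n1 n2].

End weights.

(* Main.v *)
Require Import Defs.
From HB Require Import structures.
From mathcomp Require Import all_boot all_order all_algebra.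
From mathcomp Require Import complex ring lra.
From mathcomp Require Import all_classical all_reals all_analysis.
From mathcomp Require Import measurable_realfun.

(** The proof compares all the oscillations involved through level sets. Say that
    constants [c Q], one for each rectangle [Q], are good at height [lam] if the
    set where [f] is farther than [lam] from [c Q] fills at most a small fixed
    proportion [jn_density] of [Q], for every [Q].

    Bisecting all the sides of a rectangle at once produces rectangles, so each
    rectangle carries an ordinary one-parameter dyadic grid, and maximal bad cells
    can be selected in it ([calderon_zygmund_rectangle]). Iterating the selection
    gives a John-Nirenberg inequality ([john_nirenberg]): if the constants are
    good at height [lam], then the level sets at height [2 * k * lam] decay
    geometrically in [k], not only for Lebesgue measure but for every weight [w]
    for which the subsets filling half of a rectangle carry a fixed proportion of
    its mass. Weights in A_infinity have this property ([Ainfty_uniform]). As a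
    consequence the oscillations around [c Q], of all orders and for all such
    weights, are bounded by multiples of powers of [lam]
    ([john_nirenberg_power]).

    Conversely a bound on one oscillation provides a height at which its
    constants are good, by Chebyshev's inequality and, when the oscillation is
    weighted by [w], because a set with small [w]-mass in a rectangle has small
    Lebesgue measure. For [f] in bmo the constants are the averages of [f]
    ([bmo_weighted_osc]); for [f] with bounded weighted oscillation they are the
    means weighted by [v] ([weighted_osc_bmo]). Replacing one constant by the other
    is harmless, as a mean is as close to [c Q] as [f] is on average
    ([wmean_close], [recenter]). *)

Set Implicit Arguments.
Unset Strict Implicit.
Unset Printing Implicit Defensive.
Import Order.TTheory GRing.Theory Num.Theory.
Import ComplexField.Normc.

Local Open Scope classical_set_scope.
Local Open Scope ring_scope.

Section countable_family.
Context (J : countType) (T : Type) (F : J -> set T).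

(** Countable additivity speaks of sequences, while the cells of a grid are
    indexed by tuples of integers; this lists a family through [pickle]. *)
Definition seq_of_family (n : nat) : set T :=
  if pickle_inv n is Some j then F j else set0.

Lemma bigcup_seq_of_family : \bigcup_n seq_of_family n = \bigcup_j F j.
Proof.
apply/seteqP; split=> x [n _].
  by rewrite /seq_of_family; case: pickle_inv => // j Fj; exists j.
by exists (pickle n) => //; rewrite /seq_of_family pickleK_inv.
Qed.

Lemma trivIset_seq_of_family : trivIset setT F -> trivIset setT seq_of_family.
Proof.
move=> tF m n _ _ [x []]; rewrite /seq_of_family.
have := @pickle_invK J m; have := @pickle_invK J n.
case: (pickle_inv n) => //= j <-; case: (pickle_inv m) => //= i <- Fi Fj.
by congr pickle; apply: tF => //; exists x.
Qed.

End countable_family.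

(** * Dyadic grids and Calderon-Zygmund selection *)

(** A grid is given by the index [idx k x] of the cell of level [k] that contains
    [x]; the cells of level [k.+1] refine those of level [k]. *)
Section dyadic.
Context d (T : measurableType d) (R : realType) (mu : {measure set T -> \bar R}).
Context (L : countType) (idx : nat -> T -> L).
Hypothesis idx_nested : forall k x y, idx k.+1 x = idx k.+1 y -> idx k x = idx k y.
Hypothesis measurable_idx : forall k i, measurable (idx k @^-1` [set i]).

Definition cell k x : set T := [set y | idx k y = idx k x].

Lemma idx_nested_le j k x y : (j <= k)%N -> idx k x = idx k y -> idx j x = idx j y.
Proof.
by move=> /subnK <-; elim: (k - j)%N => // m IH; rewrite addSn => /idx_nested/IH.
Qed.

Lemma measurable_cell k x : measurable (cell k x).
Proof. exact: measurable_idx. Qed.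

Definition union_of_cells (B : set T) := exists k (S : set L), B = idx k @^-1` S.

Lemma union_of_cells_level k B : union_of_cells B ->
  exists j (S : set L), (k <= j)%N /\ B = idx j @^-1` S.
Proof.
move=> [j [S ->]]; exists (maxn j k), (idx (maxn j k) @` (idx j @^-1` S)).
split; first exact: leq_maxr.
apply/seteqP; split=> x /=; first by exists x.
by move=> [y Sy /(idx_nested_le (leq_maxl j k)) <-].
Qed.

Lemma union_of_cellsC B : union_of_cells B -> union_of_cells (~` B).
Proof. by move=> [k [S ->]]; exists k, (~` S). Qed.

Lemma union_of_cellsU A B : union_of_cells A -> union_of_cells B -> union_of_cells (A `|` B).
Proof.
move=> [k [S ->]] /(union_of_cells_level k)[j [S' [kj ->]]].
exists j, (idx j @` (idx k @^-1` S) `|` S').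
apply/seteqP; split=> x /= [h|h]; [|by right| |by right]; left; first by exists x.
by move: h => [y Sy /(idx_nested_le kj) <-].
Qed.

Lemma measurable_union_of_cells B : union_of_cells B -> measurable B.
Proof.
move=> [k [S ->]].
rewrite (_ : _ @^-1` _ =
  \bigcup_n seq_of_family (fun i : L => [set x | S i /\ idx k x = i]) n).
  apply: bigcupT_measurable => n; rewrite /seq_of_family.
  case: pickle_inv => // i; have [Si|nSi] := pselect (S i).
    rewrite (_ : [set _ | _] = idx k @^-1` [set i]); first exact: measurable_idx.
    by apply/seteqP; split=> x //= [].
  by rewrite (_ : [set _ | _] = set0) // -subset0 => x [].
rewrite bigcup_seq_of_family; apply/seteqP; split=> x /=; first by exists (idx k x).
by move=> [i _ [Si ->]].
Qed.

Definition sdiff (A B : set T) := (A `\` B) `|` (B `\` A).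

Definition approximable (D A : set T) := measurable A /\
  forall e : R, 0 < e -> exists2 B, union_of_cells B & (mu (D `&` sdiff A B) < e%:E)%E.

Section approx.
Variable D : set T.
Hypotheses (mD : measurable D) (Doo : (mu D < +oo)%E).

Lemma measurable_sdiff A B : measurable A -> measurable B -> measurable (D `&` sdiff A B).
Proof.
by move=> mA mB; apply: measurableI => //; apply: measurableU; exact: measurableD.
Qed.

Lemma union_of_cells_approximable B : union_of_cells B -> approximable D B.
Proof.
move=> cB; split; first exact: measurable_union_of_cells.
by move=> e e0; exists B => //; rewrite /sdiff setDv setU0 setI0 measure0 lte_fin.
Qed.

Lemma approximableC A : approximable D A -> approximable D (~` A).
Proof.
move=> [mA hA]; split; first exact: measurableC.
move=> e /hA[B cB h]; exists (~` B); first exact: union_of_cellsC.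
by rewrite /sdiff !setDE !setCK [_ `&` B]setIC [_ `&` A]setIC setUC.
Qed.

Lemma mu_sdiff_triangle A B C : measurable A -> measurable B -> measurable C ->
  (mu (D `&` sdiff A C) <= mu (D `&` sdiff A B) + mu (D `&` sdiff B C))%E.
Proof.
move=> mA mB mC; apply: (le_trans _ (measureU2 _ _ _)) => //; [|exact: measurable_sdiff..].
apply: le_measure; rewrite ?inE; [exact: measurable_sdiff| |].
  by apply: measurableU; exact: measurable_sdiff.
rewrite /sdiff => x /= [Dx].
by have [] := pselect (B x); tauto.
Qed.

Lemma approximable_limit A : measurable A ->
  (forall e : R, 0 < e -> exists2 B, approximable D B & (mu (D `&` sdiff A B) < e%:E)%E) ->
  approximable D A.
Proof.
move=> mA h; split=> // e e0; have e20 : 0 < e / 2 by rewrite divr_gt0.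
have [B [mB /(_ _ e20)[C cC hC]] hB] := h _ e20; exists C => //.
apply: le_lt_trans (mu_sdiff_triangle mA mB (measurable_union_of_cells cC)) _.
by rewrite [e]splitr EFinD lteD.
Qed.

Lemma approximableU A B : approximable D A -> approximable D B -> approximable D (A `|` B).
Proof.
move=> [mA hA] [mB hB]; split; first exact: measurableU.
move=> e e0; have e20 : 0 < e / 2 by rewrite divr_gt0.
have [A' cA hA'] := hA _ e20; have [B' cB hB'] := hB _ e20.
have [mA' mB'] := (measurable_union_of_cells cA, measurable_union_of_cells cB).
exists (A' `|` B'); first exact: union_of_cellsU.
rewrite [e]splitr EFinD; apply: le_lt_trans (lteD hA' hB').
apply: (le_trans _ (measureU2 _ _ _)) => //; [|exact: measurable_sdiff..].
apply: le_measure; rewrite ?inE; [|by apply: measurableU; exact: measurable_sdiff|].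
  by apply: measurable_sdiff; exact: measurableU.
by rewrite /sdiff => x /=; tauto.
Qed.

(** The finite unions increase to the whole union, and [D] has finite measure,
    so that one of them is already close to the union in measure; finite unions
    are handled by [approximableU]. *)
Lemma approximable_bigcup (A : (set T)^nat) : (forall n, approximable D (A n)) ->
  approximable D (\bigcup_n A n).
Proof.
move=> hA; have mA n : measurable (A n) by case: (hA n).
have mU : measurable (\bigcup_n A n) by exact: bigcupT_measurable.
pose F n := \big[setU/set0]_(i < n) A i.
have aF n : approximable D (F n).
  rewrite /F; elim: n => [|n IH]; last by rewrite big_ord_recr /=; exact: approximableU.
  rewrite big_ord0; apply: union_of_cells_approximable; exists 0%N, set0.
  by rewrite preimage_set0.
have mF n : measurable (F n) by case: (aF n).
apply: approximable_limit => // e e0.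
pose G n := D `&` (\bigcup_n A n `\` F n).
have mG n : measurable (G n) by apply: measurableI => //; exact: measurableD.
have : mu \o G @ \oo --> mu (\bigcap_n G n).
  apply: nonincreasing_cvg_mu => //.
  - by apply: le_lt_trans Doo; apply: le_measure; rewrite ?inE //; exact: subIsetl.
  - exact: bigcapT_measurable.
  - move=> m n mn; apply/subsetPset; apply: setIS; apply: setDS.
    exact: subset_bigsetU.
rewrite (_ : \bigcap_n G n = set0); last first.
  rewrite -subset0 => x Gx; have [Dx [[n _ An] _]] := Gx 0%N I.
  have [_ [_ ]] := Gx n.+1 I; apply.
  by rewrite /F -bigcup_mkord; exists n => //=.
rewrite measure0 => /fine_cvgP[fG /cvgrPdist_lt/(_ _ e0) hG].
have [n _ /(_ n (leqnn n))[h1 h2]] : \forall n \near \oo,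
    mu (G n) \is a fin_num /\ `|0 - fine (mu (G n))| < e.
  by apply: filterI.
exists (F n) => //.
have -> : D `&` sdiff (\bigcup_n A n) (F n) = G n.
  rewrite /sdiff /G; congr (_ `&` _); rewrite (_ : F n `\` _ = set0) ?setU0 //.
  by rewrite -subset0 /F -bigcup_mkord => x [[i _ Ai]]; apply; exists i.
rewrite -(fineK h1) lte_fin; apply: le_lt_trans h2.
by rewrite sub0r normrN ler_norm.
Qed.

(** It is therefore enough to approximate a generating class of sets in order to
    approximate every set; this plays the part of Lebesgue's differentiation
    theorem in the selection below. *)
Lemma sigma_algebra_approximable : sigma_algebra setT (approximable D).
Proof.
split.
- by apply: union_of_cells_approximable; exists 0%N, set0; rewrite preimage_set0.
- by move=> A hA; rewrite setTD; exact: approximableC.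
- exact: approximable_bigcup.
Qed.

End approx.

Lemma le_measure_bigcup (F : nat -> set T) (E : set T) (a : R) :
  (0 <= a)%R -> measurable E ->
  (forall n, measurable (F n)) -> trivIset setT F ->
  (forall n, mu (E `&` F n) <= a%:E * mu (F n))%E ->
  (mu (E `&` \bigcup_n F n) <= a%:E * mu (\bigcup_n F n))%E.
Proof.
move=> a0 mE mF tF h; rewrite setI_bigcupr !measure_bigcup //.
- by rewrite -nneseriesZl //; apply: lee_nneseries.
- by move=> n _; exact: measurableI.
- by apply: trivIset_setIl.
Qed.

Lemma trivIset_level k (S : set L) :
  trivIset setT (seq_of_family (fun i : L => [set x | S i /\ idx k x = i])).
Proof.
by apply: trivIset_seq_of_family => i j _ _ [x [[_ <-] [_ <-]]].
Qed.

Lemma bigcup_level k (S : set L) :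
  \bigcup_n seq_of_family (fun i : L => [set x | S i /\ idx k x = i]) n = idx k @^-1` S.
Proof.
rewrite bigcup_seq_of_family; apply/seteqP; split=> x /=; last by exists (idx k x).
by move=> [i _ [Si ->]].
Qed.

Lemma seq_of_levelP k (S : set L) n :
  let F := seq_of_family (fun i : L => [set x | S i /\ idx k x = i]) n in
  F = set0 \/ exists2 x, S (idx k x) & F = cell k x.
Proof.
rewrite /= /seq_of_family; case: pickle_inv => [i|]; last by left.
have [[x [Si xi]]|h] := pselect (exists x, S i /\ idx k x = i).
  right; exists x; first by rewrite xi.
  by apply/seteqP; split=> y /=; rewrite /cell /= xi // => -[].
by left; rewrite -subset0 => x Fx; apply: h; exists x.
Qed.

(** Up to [e], the set [E] is a union [B] of cells. Summing the hypothesis over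
    the cells of [B] gives [mu E <= a * (mu E + e) + e], and [a < 1]. *)
Lemma measure0_of_low_density x0 (E : set T) (a : R) :
  (mu (cell 0 x0) < +oo)%E -> approximable (cell 0 x0) E -> E `<=` cell 0 x0 ->
  0 <= a < 1 ->
  (forall k x, cell 0 x0 x -> mu (E `&` cell k x) <= a%:E * mu (cell k x))%E ->
  mu E = 0%E.
Proof.
set D := cell 0 x0 => Doo [mE hE] ED /andP[a0 a1] h.
have mD : measurable D by exact: measurable_cell.
have Eoo : mu E \is a fin_num.
  by rewrite ge0_fin_numE // (le_lt_trans _ Doo) // le_measure ?inE.
have key (e : R) : 0 < e -> fine (mu E) <= a * (fine (mu E) + e) + e.
  move=> e0; have [B cB hB] := hE _ e0.
  have mB := measurable_union_of_cells cB.
  have DBoo : mu (D `&` B) \is a fin_num.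
    rewrite ge0_fin_numE // (le_lt_trans _ Doo) //.
    by apply: le_measure; rewrite ?inE //; exact: measurableI.
  have mDB : measurable (D `&` B) by exact: measurableI.
  have dle (P Q : set T) : measurable P -> measurable Q ->
      P `<=` Q `|` (D `&` sdiff E B) -> (mu P <= mu Q + e%:E)%E.
    move=> mP mQ PQ; apply: le_trans (leeD2l _ (ltW hB)).
    have mS := measurable_sdiff mD mE mB.
    apply: (le_trans _ (measureU2 _ _ _)) => //.
    by apply: le_measure; rewrite ?inE //; exact: measurableU.
  have h1 : (mu E <= mu (E `&` (D `&` B)) + e%:E)%E.
    apply: dle => //; first exact: measurableI.
    by rewrite /sdiff => x /[dup]/ED /=; have [] := pselect (B x); tauto.
  have h3 : (mu (D `&` B) <= mu E + e%:E)%E.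
    by apply: dle => // x; rewrite /sdiff /=; have [] := pselect (E x); tauto.
  have h2 : (mu (E `&` (D `&` B)) <= a%:E * mu (D `&` B))%E.
    have [k [S BS]] := cB.
    have -> : D `&` B = idx k @^-1` (idx k @` (D `&` B)).
      apply/seteqP; split=> x /=; first by exists x.
      rewrite BS => -[y [Dy Sy] yx]; split; last by rewrite /= -yx.
      by rewrite /D /cell /= -(idx_nested_le (leq0n k) yx).
    rewrite -bigcup_level; apply: le_measure_bigcup => //; last 2 first.
    - exact: trivIset_level.
    - move=> n; have [->|[x]] := seq_of_levelP k (idx k @` (D `&` B)) n.
        by rewrite setI0 measure0 mule0.
      move=> [y [Dy _]] yx ->; apply: h.
      by rewrite /D /cell /= -(idx_nested_le (leq0n k) yx).
    - move=> n; have [->|[x _ ->]] := seq_of_levelP k (idx k @` (D `&` B)) n => //.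
      exact: measurable_cell.
  move: h1 h2 h3; rewrite -(fineK Eoo) -(fineK DBoo).
  have h4 : mu (E `&` (D `&` B)) \is a fin_num.
    rewrite ge0_fin_numE // (le_lt_trans _ Doo) //.
    by apply: le_measure; rewrite ?inE //; [exact: measurableI|move=> x [_ []]].
  rewrite -(fineK h4) -EFinM -!EFinD !lee_fin => h1 h2 h3.
  apply: (le_trans h1); rewrite lerD2r (le_trans h2) //.
  by rewrite ler_wpM2l.
apply/eqP; rewrite eq_le measure_ge0 andbT -(fineK Eoo) lee_fin.
apply/ler_addgt0Pl => e e0; rewrite addr0.
have e10 : 0 < e * (1 - a) / 2 by rewrite divr_gt0 // mulr_gt0 // subr_gt0.
have := key _ e10; set m := fine _ => hm.
have : (1 - a) * m <= (1 - a) * e by nra.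
by rewrite ler_pM2l // subr_gt0.
Qed.

(** The sets [Q n] are the maximal cells in which [E] has density larger than
    [a]. Cells not contained in a selected one have density at most [a], so that
    what remains of [E] is null by [measure0_of_low_density]; and the parent of
    a selected cell is not selected, whence the last inequality. *)
Lemma calderon_zygmund x0 (E : set T) (a : R) :
  (forall A, measurable A -> approximable (cell 0 x0) A) ->
  (mu (cell 0 x0) < +oo)%E -> measurable E -> E `<=` cell 0 x0 -> 0 < a < 1 ->
  (mu E <= a%:E * mu (cell 0 x0))%E ->
  exists Q : nat -> set T,
   [/\ trivIset setT Q, \bigcup_n Q n `<=` cell 0 x0,
      forall n, measurable (Q n),
      mu (E `\` \bigcup_n Q n) = 0%E &
      forall n, Q n = set0 \/ exists k x, [/\ Q n = cell k.+1 x,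
        cell 0 x0 x, (a%:E * mu (Q n) < mu (E `&` Q n))%E &
        (mu (E `&` cell k x) <= a%:E * mu (cell k x))%E]].
Proof.
set D := cell 0 x0 => hA Doo mE ED /andP[a0 a1] ED_small.
pose bad k x := (a%:E * mu (cell k x) < mu (E `&` cell k x))%E.
pose stop k x := bad k x /\ forall j, (j < k)%N -> ~ bad j x.
have cell_eq j k x y : (j <= k)%N -> cell k x y -> cell j y = cell j x.
  by move=> jk h; rewrite /cell (idx_nested_le jk h).
have stop_cell k x y : cell k x y -> stop k x -> stop k y.
  move=> xy [b nb]; split; first by rewrite /bad (cell_eq _ _ _ _ _ xy).
  by move=> j jk; rewrite /bad (cell_eq _ _ _ _ _ xy) ?(ltnW jk)//; exact: nb.
pose F (ki : nat * L) : set T := [set x | [/\ D x, stop ki.1 x & idx ki.1 x = ki.2]].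
have FE k i x : F (k, i) x -> F (k, i) = cell k x.
  move=> [/= Dx sx xi]; apply/seteqP; split=> y; rewrite /cell /=.
    by move=> [/= _ _ ->].
  move=> yx; split => /=; [|exact: stop_cell sx|by rewrite yx].
  by rewrite /D /cell /= (idx_nested_le (leq0n k) yx).
have nb0 x : D x -> ~ bad 0 x.
  move=> Dx; rewrite /bad (cell_eq 0 0 x0 x)//; apply/negP; rewrite -leNgt.
  by rewrite (setIidl ED).
have FP ki : F ki = set0 \/ exists k x, [/\ F ki = cell k.+1 x,
    D x, bad k.+1 x & (mu (E `&` cell k x) <= a%:E * mu (cell k x))%E].
  case: ki => k i; have [/eqP|/set0P[x Fx]] := boolP (F (k, i) == set0); first by left.
  right; have := FE _ _ _ Fx; case: Fx => /= Dx [b nb] xi FxE.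
  case: k b nb xi FxE => [/(nb0 _ Dx)//|k b nb xi FxE].
  exists k, x; split=> //; rewrite leNgt; apply/negP; exact: nb.
have tF : trivIset setT F.
  move=> [k i] [k' i'] _ _ [x [[/= Dx [b nb] <-] [/= _ [b' nb'] <-]]].
  suff -> : k = k' by [].
  apply/eqP; rewrite eqn_leq; apply/andP; split; rewrite leqNgt; apply/negP => lt.
    exact: nb lt b'.
  exact: nb' lt b.
have UF : \bigcup_n seq_of_family F n = [set x | D x /\ exists k, bad k x].
  rewrite bigcup_seq_of_family; apply/seteqP; split=> x /=.
    by move=> [[k i] _ [Dx [b _] _]]; split=> //; exists k.
  move=> [Dx ex]; have ex' : exists k, `[< bad k x >] by case: ex => k ?; exists k; apply/asboolP.
  exists (ex_minn ex', idx (ex_minn ex') x) => //; split=> //=.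
  case: ex_minnP => k /asboolP b mk; split=> // j jk /asboolP /mk.
  by rewrite leqNgt jk.
have mF n : measurable (seq_of_family F n).
  rewrite /seq_of_family; case: pickle_inv => // ki.
  by have [->//|[k [x [-> _ _ _]]]] := FP ki; exact: measurable_cell.
have mU : measurable (\bigcup_n seq_of_family F n) by exact: bigcupT_measurable.
exists (seq_of_family F); split => //.
- exact: trivIset_seq_of_family.
- by rewrite UF => x [].
- have mEU := measurableD mE mU.
  apply: (@measure0_of_low_density x0 _ a) => //.
  + exact: hA.
  + by move=> x [/ED].
  + by rewrite (ltW a0).
  + move=> k x Dx; have mc := measurable_cell k x.
    have [b|nb] := pselect (bad k x).
      rewrite (_ : _ `&` _ = set0) ?measure0; last first.
        rewrite -subset0 => y [[Ey +] xy]; rewrite UF; apply; split; first exact: ED.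
        by exists k; rewrite /bad (cell_eq _ _ _ _ _ xy).
      by rewrite mule_ge0 // lee_fin ltW.
    apply: (@le_trans _ _ (mu (E `&` cell k x))); last by rewrite leNgt; apply/negP.
    apply: le_measure; rewrite ?inE; [exact: measurableI..|].
    by apply: setSI => y [].
- move=> n; rewrite /seq_of_family; case: pickle_inv => [ki|]; last by left.
  have [->|[k [x [-> Dx b hk]]]] := FP ki; first by left.
  by right; exists k, x.
Qed.

End dyadic.

(** * Cubes, rectangles and their measures *)

(** Half-open cubes [hcube] tile the space, whereas the cubes of the theory are
    the closed ones [ccube]; the two differ by a null set. *)
Section cubes.
Context (R : realType) (n : nat).

Definition box (A : 'I_n -> set R) : set (euclid R n) :=
  [set x | forall i, A i (tnth x i)].

Lemma measurable_box (A : 'I_n -> set (measurableTypeR R)) :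
  (forall i, measurable (A i)) -> measurable (box A).
Proof.
move=> mA; rewrite (_ : box A = \big[setI/setT]_(i < n) (@tnth n _ ^~ i @^-1` A i)).
  apply: bigsetI_measurable => i _; rewrite -[X in measurable X]setTI.
  exact: (@measurable_tnth _ (measurableTypeR R) n i).
rewrite -bigcap_seq; apply/seteqP; split=> x h i; first by move=> _; exact: h.
by apply: h; rewrite /= mem_index_enum.
Qed.

Definition hcube (c : euclid R n) (s : R) : set (euclid R n) :=
  box (fun i => [set` `[tnth c i, tnth c i + s[%R]).
Definition ccube (c : euclid R n) (s : R) : set (euclid R n) :=
  box (fun i => [set` `[tnth c i, tnth c i + s]%R]).

Lemma hcube_ccube c s : hcube c s `<=` ccube c s.
Proof.
by move=> x h i; have /= := h i; rewrite !in_itv /= => /andP[-> /ltW ->].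
Qed.

Lemma measurable_hcube c s : measurable (hcube c s).
Proof. by apply: measurable_box => i; exact: measurable_itv. Qed.

Lemma measurable_ccube c s : measurable (ccube c s).
Proof. by apply: measurable_box => i; exact: measurable_itv. Qed.

End cubes.

Lemma borel_lebesgue_box (R : realType) n (A : 'I_n -> set (measurableTypeR R)) (s : R) :
  (forall i, measurable (A i)) ->
  (forall i, (@lebesgue_measure R) (A i) = s%:E) ->
  borel_lebesgue R n (box A) = (s ^+ n)%:E.
Proof.
elim: n A => [|n IH] A mA hA.
  by rewrite /= diracE mem_set // => -[].
rewrite [LHS]/= /cons_measure /pushforward.
rewrite (_ : @tcons R n @^-1` _ = A ord0 `*` box (fun i => A (lift ord0 i))); last first.
  apply/seteqP; split=> -[x y] /=.
    move=> h; split; first by have := h ord0; rewrite tnth0.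
    by move=> i; have := h (lift ord0 i); rewrite /tcons /= tnthS.
  move=> [h0 h] i; have [j ->|->] := unliftP ord0 i; last by rewrite tnth0.
  by rewrite /tcons /= tnthS; exact: h.
have := @product_measure1E _ _ _ _ R (@lebesgue_measure R) (borel_lebesgue R n)
  (A ord0) (box (fun i => A (lift ord0 i))).
move=> -> //; last exact: measurable_box.
by rewrite exprS EFinM; congr mule; [exact: hA|exact: IH].
Qed.

Lemma borel_lebesgue_hcube (R : realType) n (c : euclid R n) s : 0 < s ->
  borel_lebesgue R n (hcube c s) = (s ^+ n)%:E.
Proof.
move=> s0; apply: borel_lebesgue_box => i; first exact: measurable_itv.
by rewrite lebesgue_measure_itv /= lte_fin ltrDl s0 -EFinB addrAC subrr add0r.
Qed.

Lemma borel_lebesgue_ccube (R : realType) n (c : euclid R n) s : 0 < s ->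
  borel_lebesgue R n (ccube c s) = (s ^+ n)%:E.
Proof.
move=> s0; apply: borel_lebesgue_box => i; first exact: measurable_itv.
by rewrite lebesgue_measure_itv /= lte_fin ltrDl s0 -EFinB addrAC subrr add0r.
Qed.

Lemma borel_lebesgue2X (R : realType) n1 n2 (A : set (euclid R n1)) (B : set (euclid R n2)) :
  measurable A -> measurable B ->
  borel_lebesgue2 R n1 n2 (A `*` B) = (borel_lebesgue R n1 A * borel_lebesgue R n2 B)%E.
Proof.
move=> mA mB.
have h := @product_measure1E _ _ _ _ R (borel_lebesgue R n1) (borel_lebesgue R n2) A B mA mB.
exact: h.
Qed.

Section rects.
Context (R : realType) (n1 n2 : nat).
Local Notation X := (euclid2 R n1 n2).
Local Notation mu := (lebesgue2 R n1 n2).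
Local Notation P := (euclid R n1 * euclid R n2)%type.
Implicit Types (c : P) (s : R * R).

Definition hrect c s : set X := hcube c.1 s.1 `*` hcube c.2 s.2.
Definition crect c s : set X := ccube c.1 s.1 `*` ccube c.2 s.2.

Lemma rectangleP Q : rectangle R n1 n2 Q <->
  exists c s, [/\ 0 < s.1, 0 < s.2 & Q = crect c s].
Proof.
split=> [[Q1 [a [l [l0 ->]]] [Q2 [b [m [m0 ->]]]] <-]|[c [s [s1 s2 ->]]]].
  exists (a, b), (l, m); split=> //; congr (_ `*` _); apply/seteqP; split=> x h i /=;
    by have := h i; rewrite /= in_itv.
exists (ccube c.1 s.1).
  by exists c.1, s.1; split=> //; apply/seteqP; split=> x h i /=; have := h i; rewrite /= in_itv.
exists (ccube c.2 s.2) => //.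
by exists c.2, s.2; split=> //; apply/seteqP; split=> x h i /=; have := h i; rewrite /= in_itv.
Qed.

Lemma measurable_borel (A : set P) : measurable A -> measurable (A : set X).
Proof. by move=> mA; exact: caratheodory_measurable_mu_ext. Qed.

Lemma lebesgue2_borel (A : set P) : measurable A -> mu A = borel_lebesgue2 R n1 n2 A.
Proof. by move=> mA; exact: measurable_mu_extE. Qed.

Lemma measurable_hrect c s : measurable (hrect c s).
Proof. by apply: measurable_borel; apply: measurableX; exact: measurable_hcube. Qed.

Lemma measurable_crect c s : measurable (crect c s).
Proof. by apply: measurable_borel; apply: measurableX; exact: measurable_ccube. Qed.

Lemma measurable_rectangle Q : rectangle R n1 n2 Q -> measurable Q.
Proof. by move=> /rectangleP[c [s [_ _ ->]]]; exact: measurable_crect. Qed.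

Lemma lebesgue2_hrect c s : 0 < s.1 -> 0 < s.2 ->
  mu (hrect c s) = (s.1 ^+ n1 * s.2 ^+ n2)%:E.
Proof.
move=> s1 s2; rewrite lebesgue2_borel; last by apply: measurableX; exact: measurable_hcube.
rewrite borel_lebesgue2X; [|exact: measurable_hcube..].
by rewrite !borel_lebesgue_hcube // EFinM.
Qed.

Lemma lebesgue2_crect c s : 0 < s.1 -> 0 < s.2 ->
  mu (crect c s) = (s.1 ^+ n1 * s.2 ^+ n2)%:E.
Proof.
move=> s1 s2; rewrite lebesgue2_borel; last by apply: measurableX; exact: measurable_ccube.
rewrite borel_lebesgue2X; [|exact: measurable_ccube..].
by rewrite !borel_lebesgue_ccube // EFinM.
Qed.

Lemma hrect_crect c s : hrect c s `<=` crect c s.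
Proof. by move=> x [h1 h2]; split; exact: hcube_ccube. Qed.

Lemma lebesgue2_boundary c s : 0 < s.1 -> 0 < s.2 ->
  mu (crect c s `\` hrect c s) = 0%E.
Proof.
move=> s1 s2.
have -> : mu (crect c s `\` hrect c s) =
    (mu (crect c s) - mu (crect c s `&` hrect c s))%E.
  apply: measureD; [exact: measurable_crect|exact: measurable_hrect|].
  by have := @lebesgue2_crect c s s1 s2 => /= ->; rewrite ltry.
by rewrite (setIidr (@hrect_crect c s)) lebesgue2_hrect // lebesgue2_crect // subee.
Qed.

Lemma lebesgue2_rectangle Q : rectangle R n1 n2 Q ->
  exists2 r : R, 0 < r & mu Q = r%:E.
Proof.
move=> /rectangleP[c [s [s1 s2 ->]]]; rewrite lebesgue2_crect //.
by exists (s.1 ^+ n1 * s.2 ^+ n2) => //; rewrite mulr_gt0 // exprn_gt0.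
Qed.

End rects.

Lemma floor_double (R : realType) (u v : R) :
  Num.floor (2 * u) = Num.floor (2 * v) -> Num.floor u = Num.floor v.
Proof.
suff h (x y : R) : Num.floor (2 * x) = Num.floor (2 * y) -> Num.floor x <= Num.floor y.
  by move=> e; apply/eqP; rewrite eq_le !h.
move=> e; rewrite floor_ge_int -(@ler_pM2l _ 2) //.
rewrite -[X in X * _ <= _]/(2%:~R) -intrM -floor_ge_int -e floor_ge_int intrM.
by rewrite ler_pM2l // floor_le.
Qed.

Definition cube_index (R : realType) n (a : euclid R n) (l : R) k (x : euclid R n) :
    n.-tuple int :=
  [tuple Num.floor (2 ^+ k * ((tnth x i - tnth a i) / l)) | i < n].

Lemma cube_index_nested (R : realType) n (a : euclid R n) l k x y :
  cube_index a l k.+1 x = cube_index a l k.+1 y -> cube_index a l k x = cube_index a l k y.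
Proof.
move=> h; apply: eq_from_tnth => i; move: (congr1 (@tnth n _ ^~ i) h).
by rewrite !tnth_mktuple !exprS -!mulrA => /floor_double.
Qed.

Lemma cube_index_cell (R : realType) n (a : euclid R n) l k m : 0 < l ->
  cube_index a l k @^-1` [set m] =
  hcube [tuple tnth a i + (tnth m i)%:~R * (l / 2 ^+ k) | i < n] (l / 2 ^+ k).
Proof.
move=> l0; have k0 : 0 < 2 ^+ k :> R by rewrite exprn_gt0.
have E (i : 'I_n) (x : euclid R n) :
  (Num.floor (2 ^+ k * ((tnth x i - tnth a i) / l)) == tnth m i) =
   (tnth a i + (tnth m i)%:~R * (l / 2 ^+ k) <= tnth x i <
     tnth a i + (tnth m i)%:~R * (l / 2 ^+ k) + l / 2 ^+ k).
  have e : tnth x i = tnth a i + (2 ^+ k * ((tnth x i - tnth a i) / l)) * (l / 2 ^+ k).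
    by field; rewrite !gt_eqF.
  rewrite [in RHS]e -addrA lerD2l ltrD2l -[X in _ < _ + X]mul1r -mulrDl.
  by rewrite ler_pM2r ?ltr_pM2r ?divr_gt0// floor_eq intrD.
apply/seteqP; split=> x /=.
  by move=> xm i; rewrite /= in_itv /= tnth_mktuple -E -xm tnth_mktuple.
move=> h; apply: eq_from_tnth => i; rewrite tnth_mktuple; apply/eqP; rewrite E.
by have := h i; rewrite /= in_itv /= tnth_mktuple.
Qed.

(** A point with [i]-th coordinate below [t] lies in a cell of some level that
    is entirely below [t]; since the cells are half-open no boundary is left, and
    the half-space is exactly a countable union of cells. *)
Lemma cube_index_ray (R : realType) n (a : euclid R n) l i t : 0 < l ->
  [set x : euclid R n | tnth x i < t] = \bigcup_k
   (cube_index a l k @^-1` [set m | tnth a i + ((tnth m i)%:~R + 1) * (l / 2 ^+ k) <= t]).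
Proof.
move=> l0; have k0 k : 0 < 2 ^+ k :> R by rewrite exprn_gt0.
pose z k (x : euclid R n) := 2 ^+ k * ((tnth x i - tnth a i) / l).
have e k x : tnth x i = tnth a i + z k x * (l / 2 ^+ k).
  by rewrite /z; field; rewrite !gt_eqF.
apply/seteqP; split=> x /=.
  move=> xt; have d0 : 0 < (t - tnth x i) / l by rewrite divr_gt0 // subr_gt0.
  have [k hk] : exists k, l / 2 ^+ k <= t - tnth x i.
    pose N := Num.bound ((t - tnth x i) / l)^-1.
    exists N; rewrite ler_pdivrMr // -ler_pdivrMl ?subr_gt0 //.
    rewrite (_ : _ * l = ((t - tnth x i) / l)^-1); last by rewrite invf_div mulrC.
    have : ((t - tnth x i) / l)^-1 <= N%:R.
      by rewrite ltW // archi_boundP // invr_ge0 ltW.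
    move=> /le_trans; apply; rewrite -natrX ler_nat.
    by rewrite ltnW // ltn_expl.
  exists k => //=; rewrite tnth_mktuple -/(z k x) mulrDl mul1r.
  rewrite -[t](subrK (tnth x i)) [t - _ + _]addrC addrA lerD // [leRHS](e k).
  by rewrite lerD2l ler_pM2r ?divr_gt0 // floor_le.
move=> [k _ /=]; rewrite tnth_mktuple -/(z k x); apply: lt_le_trans.
rewrite [ltLHS](e k) ltrD2l ltr_pM2r ?divr_gt0 //.
by have := floorD1_gt (z k x); rewrite intrD.
Qed.

(** * Selection inside a rectangle *)

Lemma preimage_sub_sigma_algebra (T U : Type) (f : T -> U) (G : set (set U))
    (H : set (set T)) :
  sigma_algebra setT H -> (forall B, G B -> H (f @^-1` B)) ->
  forall B, <<s G >> B -> H (f @^-1` B).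
Proof.
move=> [H0 HC HU] GH.
suff : <<s G >> `<=` [set B | H (f @^-1` B)] by [].
apply: smallest_sub; last by move=> A /GH.
split => /=.
- by rewrite preimage_set0.
- by move=> A /HC; rewrite !setTD preimage_setC.
- by move=> A hA; rewrite preimage_bigcup; exact: HU.
Qed.

(** All the sides of a rectangle are bisected simultaneously. The cells are then
    rectangles again, and they form a one-parameter dyadic grid: this is why the
    classical one-parameter arguments apply to the two-parameter family of
    rectangles. *)
Section grid.
Context (R : realType) (n1 n2 : nat).
Local Notation X := (euclid2 R n1 n2).
Local Notation mu := (lebesgue2 R n1 n2).
Local Notation P := (euclid R n1 * euclid R n2)%type.
Context (c : P) (s : R * R).
Hypotheses (s1 : 0 < s.1) (s2 : 0 < s.2).

Definition rect_index k (x : X) : n1.-tuple int * n2.-tuple int :=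
  (cube_index c.1 s.1 k x.1, cube_index c.2 s.2 k x.2).

Lemma rect_index_nested k (x y : X) :
  rect_index k.+1 x = rect_index k.+1 y -> rect_index k x = rect_index k y.
Proof.
move=> h; congr pair; apply: cube_index_nested.
  exact: (congr1 fst h).
exact: (congr1 snd h).
Qed.

Definition cell_size k : R * R := (s.1 / 2 ^+ k, s.2 / 2 ^+ k).

Definition cell_corner k (m : n1.-tuple int * n2.-tuple int) : P :=
  ([tuple tnth c.1 i + (tnth m.1 i)%:~R * (s.1 / 2 ^+ k) | i < n1],
   [tuple tnth c.2 i + (tnth m.2 i)%:~R * (s.2 / 2 ^+ k) | i < n2]).

Lemma rect_index_cell k m :
  rect_index k @^-1` [set m] = hrect (cell_corner k m) (cell_size k).
Proof.
rewrite /hrect /= -!cube_index_cell //.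
apply/seteqP; split=> x; first by move=> <-.
case: m => m1 m2 h; exact: congr2 (h.1 : cube_index c.1 s.1 k x.1 = m1) h.2.
Qed.

Lemma cell_size_gt0 k : 0 < (cell_size k).1 /\ 0 < (cell_size k).2.
Proof. by split; rewrite divr_gt0 ?exprn_gt0. Qed.

Lemma measurable_rect_index k m : measurable (rect_index k @^-1` [set m]).
Proof. by rewrite rect_index_cell; exact: measurable_hrect. Qed.

Local Notation cell := (cell rect_index).

Lemma cell_hrect k x : cell k x = hrect (cell_corner k (rect_index k x)) (cell_size k).
Proof. exact: rect_index_cell. Qed.

Lemma lebesgue2_cell k x :
  mu (cell k x) = ((s.1 / 2 ^+ k) ^+ n1 * (s.2 / 2 ^+ k) ^+ n2)%:E.
Proof. by rewrite cell_hrect lebesgue2_hrect; case: (cell_size_gt0 k). Qed.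

Lemma lebesgue2_cell_parent k x :
  mu (cell k x) = ((2 ^+ (n1 + n2))%:E * mu (cell k.+1 x))%E.
Proof.
have half (r : R) : r / 2 ^+ k = 2 * (r / 2 ^+ k.+1).
  by rewrite exprS; field; rewrite expf_neq0.
by rewrite !lebesgue2_cell -EFinM !half !exprMn mulrACA exprD.
Qed.

Lemma cell0 : cell 0 (c : X) = hrect c s.
Proof.
rewrite cell_hrect /cell_size expr0 !divr1 -surjective_pairing; congr hrect.
rewrite [RHS]surjective_pairing /cell_corner /rect_index /=; congr pair;
  apply: eq_from_tnth => i; rewrite !tnth_mktuple subrr mul0r mulr0 floor0;
  by rewrite mul0r addr0.
Qed.

Local Notation D := (cell 0 (c : X)).

Lemma lebesgue2_cell0_lty : (mu D < +oo)%E.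
Proof. by rewrite lebesgue2_cell ltry. Qed.

(** Half-spaces generate the Borel sets and are countable unions of cells. *)
Lemma approximable_borel (A : set P) : measurable A ->
  approximable mu rect_index D (A : set X).
Proof.
have mD : measurable D by rewrite cell0; exact: measurable_hrect.
have SA := @sigma_algebra_approximable _ _ _ mu _ _ rect_index_nested
  measurable_rect_index D mD lebesgue2_cell0_lty.
have [_ _ HU] := SA.
apply: (preimage_sub_sigma_algebra (f := id)) => //.
have coord n (f : X -> euclid R n) (i : 'I_n) (B : set (measurableTypeR R)) :
    (forall t, approximable mu rect_index D [set x | tnth (f x) i < t]) ->
    measurable B -> approximable mu rect_index D [set x | B (tnth (f x) i)].
  move=> h mB.
  have {mB} : <<s @measurable_realfun.RGenCInfty.G R >> B.
    have mE := measurable_realfun.RGenCInfty.measurableE R.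
    exact: (eq_ind _ (fun M : set (set R) => M B) mB _ mE).
  apply: (preimage_sub_sigma_algebra (f := fun x : X => tnth (f x) i)) => //.
  move=> _ [t ->]; have [_ HC _] := SA; have := HC _ (h t).
  rewrite setTD; congr (approximable _ _ _ _); apply/seteqP; split=> x /=;
    by rewrite in_itv /= andbT leNgt => /negP.
have tup n (f : X -> euclid R n) (B : set (euclid R n)) :
    (forall i t, approximable mu rect_index D [set x | tnth (f x) i < t]) ->
    measurable B -> approximable mu rect_index D (f @^-1` B).
  move=> h; apply: preimage_sub_sigma_algebra => // B'.
  have -> : \big[setU/set0]_(i < n) preimage_set_system setT
       (fun x : euclid R n => tnth x i) (@measurable _ (measurableTypeR R)) =
    \bigcup_(i : 'I_n) preimage_set_system setT
       (fun x : euclid R n => tnth x i) (@measurable _ (measurableTypeR R)).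
    rewrite -bigcup_seq; apply/seteqP; split=> x [i _ ?]; exists i => //=.
    exact: mem_index_enum.
  move=> [i _ [C mC <-]]; rewrite setTI; exact: coord.
have lvl k (S : set (n1.-tuple int * n2.-tuple int)) :
    approximable mu rect_index D (rect_index k @^-1` S).
  apply: union_of_cells_approximable => //; [exact: measurable_rect_index|by exists k, S].
move=> B [|] [C mC <-]; rewrite setTI; apply: tup => // i t.
  have -> : [set x : X | tnth x.1 i < t] =
     (fun x : X => x.1) @^-1` [set x : euclid R n1 | tnth x i < t] by [].
  rewrite (cube_index_ray c.1 i t s1) preimage_bigcup; apply: HU => k.
  exact: (lvl k [set m | tnth c.1 i + ((tnth m.1 i)%:~R + 1) * (s.1 / 2 ^+ k) <= t]).
have -> : [set x : X | tnth x.2 i < t] =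
   (fun x : X => x.2) @^-1` [set x : euclid R n2 | tnth x i < t] by [].
rewrite (cube_index_ray c.2 i t s2) preimage_bigcup; apply: HU => k.
exact: (lvl k [set m | tnth c.2 i + ((tnth m.2 i)%:~R + 1) * (s.2 / 2 ^+ k) <= t]).
Qed.

(** A Lebesgue measurable set is covered by a Borel set of almost the same
    measure, because the outer measure is an infimum over Borel covers. *)
Lemma approximable_lebesgue (A : set X) : measurable A -> approximable mu rect_index D A.
Proof.
move=> mA; have mD : measurable D by rewrite cell0; exact: measurable_hrect.
apply: (approximable_limit measurable_rect_index) => // e e0.
have mDA : measurable (D `&` A) by exact: measurableI.
have DAoo : mu (D `&` A) \is a fin_num.
  rewrite ge0_fin_numE // (le_lt_trans _ lebesgue2_cell0_lty) //.
  by apply: le_measure; rewrite ?inE.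
have [F [mF DAF] hF] : exists2 F, measurable_cover (D `&` A : set P) F &
    (\sum_(k <oo) borel_lebesgue2 R n1 n2 (F k) < mu (D `&` A) + e%:E)%E.
  have [_ [F hF <-] h] := lb_ereal_inf_adherent e0 DAoo.
  by exists F.
have mUF : measurable (\bigcup_k F k : set P) by exact: bigcupT_measurable.
exists (\bigcup_k F k); first exact: approximable_borel.
have mUF' : measurable (\bigcup_k F k : set X) by exact: measurable_borel.
have -> : D `&` sdiff A (\bigcup_k F k) = (D `&` \bigcup_k F k) `\` (D `&` A).
  by apply/seteqP; rewrite /sdiff; split=> x /=; have := DAF x; rewrite /=; tauto.
have mDF : measurable (D `&` \bigcup_k F k) by exact: measurableI.
have -> : mu ((D `&` \bigcup_k F k) `\` (D `&` A)) = (mu (D `&` \bigcup_k F k) -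
   mu ((D `&` \bigcup_k F k) `&` (D `&` A)))%E.
  apply: measureD => //; rewrite (le_lt_trans _ lebesgue2_cell0_lty) //.
  by apply: le_measure; rewrite ?inE.
have -> : (D `&` \bigcup_k F k) `&` (D `&` A) = D `&` A.
  by apply/seteqP; split=> x /=; have := DAF x; rewrite /=; tauto.
rewrite lteBlDl //; apply: le_lt_trans hF.
apply: (@le_trans _ _ (mu (\bigcup_k F k))); first by apply: le_measure; rewrite ?inE.
rewrite lebesgue2_borel //.
apply: (measure_sigma_subadditive _ mF) => //.
Qed.

End grid.

Section calderon_zygmund_rectangle.
Context (R : realType) (n1 n2 : nat).
Local Notation X := (euclid2 R n1 n2).
Local Notation mu := (lebesgue2 R n1 n2).

(** The selected sets [F n] are half-open cells, each of them almost equal to the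
    closed rectangle [Q']. The factor [2 ^+ (n1 + n2)] is the ratio between the
    measures of a cell and of its children. *)
Lemma calderon_zygmund_rectangle (Q E : set X) (a : R) :
  rectangle R n1 n2 Q -> measurable E -> E `<=` Q -> 0 < a < 1 ->
  (mu E <= a%:E * mu Q)%E ->
  exists F : nat -> set X,
   [/\ trivIset setT F, \bigcup_n F n `<=` Q, forall n, measurable (F n),
      mu (E `\` \bigcup_n F n) = 0%E &
      forall n, F n = set0 \/ exists Q', [/\ rectangle R n1 n2 Q', F n `<=` Q',
        mu (Q' `\` F n) = 0%E,
        (a%:E * mu (F n) < mu (E `&` F n))%E &
        (mu (E `&` F n) <= (2 ^+ (n1 + n2) * a)%:E * mu (F n))%E]].
Proof.
move=> /rectangleP[c [s [s1 s2 QE]]] mE EQ a01 hE.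
have mQ : measurable Q by rewrite QE; exact: measurable_crect.
pose H := hrect c s; have mH : measurable H by exact: measurable_hrect.
have D0 : cell (rect_index c s) 0 c = H by exact: cell0.
have HQ : H `<=` Q by rewrite QE; exact: hrect_crect.
have QH0 : mu (Q `\` H) = 0%E by rewrite QE; exact: lebesgue2_boundary.
have muQ : mu Q = mu H by rewrite QE lebesgue2_crect // lebesgue2_hrect.
have mEH : measurable (E `&` H) by exact: measurableI.
have [||||//||F [tF FD mF EF0 hF]] := @calderon_zygmund _ _ _ mu _ _
  (@rect_index_nested R n1 n2 c s) (measurable_rect_index c s1 s2) c (E `&` H) a.
- exact: approximable_lebesgue.
- exact: lebesgue2_cell0_lty.
- exact: mEH.
- by rewrite D0.
- rewrite D0 -muQ (le_trans _ hE) //; apply: le_measure; rewrite ?inE //.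
have FH n : F n `<=` H by rewrite -D0 => x Fx; apply: FD; exists n.
exists F; split=> //.
- by move=> x /FD; rewrite D0 => /HQ.
- have mU : measurable (\bigcup_n F n) by exact: bigcupT_measurable.
  apply/eqP; rewrite eq_le measure_ge0 andbT.
  apply: (@le_trans _ _ (mu ((E `&` H) `\` \bigcup_n F n) + mu (Q `\` H))%E).
    apply: (le_trans _ (measureU2 _ _ _)); [|exact: measurableD..].
    apply: le_measure; rewrite ?inE.
    + exact: measurableD.
    + by apply: measurableU; exact: measurableD.
    + by move=> x [Ex nF]; have := EQ _ Ex; have [] := pselect (H x); rewrite /=; tauto.
  by rewrite EF0 QH0 adde0.
- move=> n; have [->|[k [x [FE Dx h1 h2]]]] := hF n; [by left|right].
  have EHF : (E `&` H) `&` F n = E `&` F n by rewrite -setIA (setIidr (FH n)).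
  have [z1 z2] := cell_size_gt0 s1 s2 k.+1.
  exists (crect (cell_corner c s k.+1 (rect_index c s k.+1 x)) (cell_size s k.+1)).
  rewrite EHF in h1; split=> //.
  + by apply/rectangleP; do 2 eexists; split; [| |reflexivity].
  + by rewrite FE cell_hrect //; exact: hrect_crect.
  + by rewrite FE cell_hrect //; exact: lebesgue2_boundary.
  + rewrite [X in (_ <= _ * mu X)%E]FE mulrC EFinM -muleA -lebesgue2_cell_parent //.
    apply: le_trans h2; apply: le_measure; rewrite ?inE.
    * by apply: measurableI.
    * by apply: measurableI => //; apply: measurable_cell; exact: measurable_rect_index.
    * rewrite -EHF FE; apply: setIS => y; exact: rect_index_nested.
Qed.

End calderon_zygmund_rectangle.

(** * John-Nirenberg inequality *)

Lemma measure_bigcupT d (T : measurableType d) (R : realType)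
    (m : {measure set T -> \bar R}) (F : nat -> set T) :
  (forall n, measurable (F n)) -> trivIset setT F ->
  m (\bigcup_n F n) = (\sum_(n <oo) m (F n))%E.
Proof.
by move=> mF tF; rewrite measure_bigcup //; apply: eq_eseriesl => n; rewrite in_setT.
Qed.

Section weights.
Context (R : realType) (n1 n2 : nat).
Local Notation X := (euclid2 R n1 n2).
Local Notation mu := (lebesgue2 R n1 n2).
Local Notation rect := (rectangle R n1 n2).
Implicit Types (w : X -> R) (f : X -> R[i]) (Q E : set X).

(** A qualitative form of the A_infinity condition: uniformly over all rectangles,
    a subset that is large for Lebesgue measure is not negligible for [w]. It
    transfers largeness from Lebesgue measure to [w] and, by contraposition,
    smallness from [w] to Lebesgue measure. *)
Definition uniform_weight w :=
  [/\ forall x, 0 <= w x, measurable_fun setT w,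
      forall Q, rect Q -> (0 < wmeas w Q < +oo)%E &
      forall a : R, 0 < a -> exists2 eta : R, 0 < eta &
        forall Q E, rect Q -> measurable E -> E `<=` Q ->
          (a%:E * mu Q <= mu E -> eta%:E * wmeas w Q <= wmeas w E)%E].

Section wmeasure.
Variable w : X -> R.
Hypotheses (w0 : forall x, 0 <= w x) (mw : measurable_fun setT w).

(** [wmeas w] carries a measure structure only thanks to the two hypotheses,
    which are therefore arguments of its alias. *)
Definition wmeasure of (forall x, 0 <= w x) & measurable_fun setT w :=
  wmeas w.
Local Notation m := (wmeasure w0 mw).

Let mEw D : measurable_fun D (EFin \o w).
Proof. by apply/measurable_EFinP; exact: measurable_funTS. Qed.

Let Ew0 x : (0 <= (w x)%:E)%E.
Proof. by rewrite lee_fin. Qed.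

Let m0 : m set0 = 0%E.
Proof. by rewrite /wmeasure /wmeas integral_set0. Qed.

Let m_ge0 A : (0 <= m A)%E.
Proof. by apply: integral_ge0 => x _; rewrite lee_fin. Qed.

Let m_sigma_additive : semi_sigma_additive m.
Proof.
move=> F mF tF mU; rewrite /wmeasure /wmeas.
rewrite (ge0_integral_bigcup mu mF (@mEw (\bigcup_n F n)) (fun x _ => Ew0 x) tF).
by apply: is_cvg_ereal_nneg_natsum_cond => n _ _; exact: m_ge0.
Qed.

HB.instance Definition _ := isMeasure.Build _ _ _ m m0 m_ge0 m_sigma_additive.

Lemma wmeasure_null A : measurable A -> mu A = 0%E -> m A = 0%E.
Proof.
by move=> mA; exact: (null_set_integral mA (@mEw A)).
Qed.

End wmeasure.

Lemma le_normc_sub (x y z : R[i]) : normc (x - z) <= normc (x - y) + normc (y - z).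
Proof. by rewrite (le_trans _ (le_normcD _ _)) // addrA subrK. Qed.

Lemma normc_distC (x y : R[i]) : normc (x - y) = normc (y - x).
Proof. by rewrite -normcN opprB. Qed.

Lemma normc_ge0 (x : R[i]) : 0 <= normc x.
Proof. by case: x => a b; rewrite sqrtr_ge0. Qed.

Lemma measurable_normc f (c : R[i]) : cmeasurable f ->
  measurable_fun setT (fun x => normc (f x - c)).
Proof.
move=> [mRe mIm].
rewrite (_ : (fun _ => _) = Num.sqrt \o (fun x =>
    (complex.Re (f x) - complex.Re c) ^+ 2 + (complex.Im (f x) - complex.Im c) ^+ 2)).
  apply: measurableT_comp.
    by apply: continuous_measurable_fun; exact: sqrt_continuous.
  by apply: measurable_funD; apply: measurable_funX; exact: measurable_funB.
by apply/funext => x /=; case: (f x) => a b; case: c.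
Qed.

Lemma measurable_normc_gt f (c : R[i]) t : cmeasurable f ->
  measurable [set x | t < normc (f x - c)].
Proof.
move=> mf; have := measurable_fun_ltr (measurable_cst t) (measurable_normc c mf).
move=> /(_ measurableT [set true]).
by rewrite setTI; apply.
Qed.

(** Twice this number is the threshold of the selection, so that selected cells
    fill at most half of a rectangle. In a selected cell, the level set of the
    ambient rectangle has density at most [2 ^+ (n1 + n2) * (2 * jn_density) = 1/4]
    and that of the cell itself at most [1/8]; as [1/4 + 1/8 < 1], some point of
    the cell avoids both. *)
Definition jn_density : R := (8 * 2 ^+ (n1 + n2))^-1.

Lemma jn_density_gt0 : 0 < jn_density.
Proof. by rewrite invr_gt0 mulr_gt0 // exprn_gt0. Qed.

Lemma jn_densityE : 2 ^+ (n1 + n2) * (2 * jn_density) = 4^-1.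
Proof. by rewrite /jn_density; field; rewrite expf_neq0. Qed.

Lemma jn_density_le : jn_density <= 8^-1.
Proof.
rewrite lef_pV2 ?posrE ?mulr_gt0 ?exprn_gt0 //.
by rewrite ler_peMr // exprn_ege1 // ler1n.
Qed.

Lemma selection_threshold : 0 < 2 * jn_density < 1.
Proof. by have := jn_density_gt0; have := jn_density_le; lra. Qed.

Lemma level_sets_miss_a_point r : 0 < r -> 4^-1 * r + jn_density * r < r.
Proof. by have := jn_density_gt0; have := jn_density_le; nra. Qed.

(** Let [A t] be the supremum over all rectangles [Q] of the [w]-proportion of
    [Q] where [f] is farther than [t] from [c Q]. The selection, applied to the
    set where [f] is farther than [lam] from [c Q], gives cells [Q'] such
    that [c Q'] is at distance at most [2 * lam] from [c Q]. Almost everywhere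
    outside of them [f] is within [lam] of [c Q]; inside, the distance from [f] to
    [c Q'] exceeds [t] when the distance to [c Q] exceeds [t + 2 * lam]. The cells
    leave half of [Q] free for Lebesgue measure, hence a fixed proportion of [Q]
    free for [w], and [A (t + 2 * lam) <= b * A t]. The hypothesis concerns Lebesgue measure and the
    conclusion [w]: the measure changes at the selection step, where the property
    of uniform weights is applied to the complement of the cells. *)
Lemma john_nirenberg w : uniform_weight w ->
  exists2 b : R, 0 <= b < 1 &
    forall f (c : set X -> R[i]) (lam : R), cmeasurable f -> 0 <= lam ->
    (forall Q, rect Q ->
      mu (Q `&` [set x | (lam < normc (f x - c Q))%R]) <= jn_density%:E * mu Q)%E ->
    forall k Q, rect Q ->
      (wmeas w (Q `&` [set x | (k%:R * (2 * lam) < normc (f x - c Q))%R]) <=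
        (b ^+ k)%:E * wmeas w Q)%E.
Proof.
move=> [w0 mw wQ hw]; have [eta eta0 heta] := hw 2^-1 ltac:(by rewrite invr_gt0).
pose m : {measure set X -> \bar R} := wmeasure w0 mw.
pose eta' := Num.min eta 1.
have eta'0 : 0 < eta' by rewrite lt_min eta0 /=.
have eta'1 : eta' <= 1 by rewrite ge_min lexx orbT.
exists (1 - eta'); first by rewrite subr_ge0 eta'1 /= ltrBlDr ltrDl.
set b := 1 - eta'; have b0 : 0 <= b by rewrite subr_ge0.
move=> f c lam mf lam0 hf.
have mG t z : measurable [set x | t < normc (f x - z)] by exact: measurable_normc_gt.
have d0 := jn_density_gt0.
elim=> [|k IH] Q rQ.
  rewrite expr0 mul1e; have mQ := measurable_rectangle rQ.
  by apply: (@le_measure _ _ _ m); rewrite ?inE //; exact: measurableI.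
have mQ := measurable_rectangle rQ.
pose E := Q `&` [set x | lam < normc (f x - c Q)].
have mE : measurable E by exact: measurableI.
have [r r0 muQ] := lebesgue2_rectangle rQ.
have [|F [tF FQ mF EF0 hF]] := @calderon_zygmund_rectangle R n1 n2 Q E (2 * jn_density)
    rQ mE (@subIsetl _ _ _) selection_threshold.
  apply: le_trans (hf _ rQ) _; rewrite muQ -!EFinM lee_fin ler_pM2r //.
  by rewrite ler_peMl ?(ltW d0) // ler1n.
have mU : measurable (\bigcup_n F n) by exact: bigcupT_measurable.
have half : (mu (\bigcup_n F n) <= (2^-1)%:E * mu Q)%E.
  have : ((2 * jn_density)%:E * mu (\bigcup_n F n) <= mu E)%E.
    apply: (@le_trans _ _ (mu (E `&` \bigcup_n F n))); last first.
      by apply: le_measure; rewrite ?inE //; exact: measurableI.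
    rewrite setI_bigcupr !measure_bigcup //.
    + rewrite -nneseriesZl //; apply: lee_nneseries => //.
        by move=> n _; rewrite mule_ge0 // lee_fin mulr_ge0 // ltW.
      move=> n _; have [->|[Q' [_ _ _ /ltW //]]] := hF n.
      by rewrite setI0 measure0 mule0.
    + by move=> n _; exact: measurableI.
    + by apply: trivIset_setIl.
  move=> /le_trans /(_ (hf _ rQ)).
  have Uoo : mu (\bigcup_n F n) \is a fin_num.
    rewrite ge0_fin_numE // (@le_lt_trans _ _ (mu Q)) ?muQ ?ltry //.
    by rewrite -muQ; apply: le_measure; rewrite ?inE.
  rewrite muQ -(fineK Uoo) -!EFinM !lee_fin => h.
  rewrite -(@ler_pM2l _ (2 * jn_density)) ?mulr_gt0 // (le_trans h) //.
  by rewrite le_eqVlt; apply/orP; left; apply/eqP; field.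
(* Free for Lebesgue measure implies free for the weight. *)
have wU : (m (\bigcup_n F n) <= b%:E * m Q)%E.
  have mQU : measurable (Q `\` \bigcup_n F n) by exact: measurableD.
  have h1 : (eta%:E * m Q <= m (Q `\` \bigcup_n F n))%E.
    apply: heta => //; have -> : mu (Q `\` \bigcup_n F n) = (mu Q - mu (Q `&` \bigcup_n F n))%E.
      by apply: measureD => //; have := muQ => /= ->; rewrite ltry.
    rewrite (setIidr FQ) leeBrDr; last first.
      rewrite ge0_fin_numE // (@le_lt_trans _ _ ((2^-1)%:E * mu Q)%E) //.
      by rewrite muQ -EFinM ltry.
    apply: le_trans (leeD2l _ half) _.
    by rewrite muQ -!EFinM -EFinD lee_fin ![2^-1 * _]mulrC -splitr.
  have mQE : (m Q = m (\bigcup_n F n) + m (Q `\` \bigcup_n F n))%E.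
    rewrite -measureU //; first by rewrite setDUK.
    by rewrite setDE setICA setICr setI0.
  have [mQ0 mQoo] := andP (wQ _ rQ).
  have mQf : m Q \is a fin_num by rewrite ge0_fin_numE.
  have h2 : (eta'%:E * m Q <= m (Q `\` \bigcup_n F n))%E.
    by apply: le_trans h1; rewrite lee_wpmul2r // lee_fin ge_min lexx.
  rewrite /b EFinB muleBl // mul1e leeBrDr; last by rewrite fin_numM.
  by rewrite [leRHS]mQE leeD2l.
rewrite exprSr EFinM -muleA.
apply: (@le_trans _ _ ((b ^+ k)%:E * m (\bigcup_n F n))%E); last first.
  by rewrite lee_wpmul2l // lee_fin exprn_ge0.
pose G := Q `&` [set x | k.+1%:R * (2 * lam) < normc (f x - c Q)].
have mGG : measurable G by exact: measurableI.
have GE : G `<=` E.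
  move=> x [Qx hx]; split => //; apply: le_lt_trans hx.
  rewrite -natr1 mulrDl mul1r -[leLHS]add0r lerD ?mulr_ge0 //.
  by rewrite ler_peMl // ler1n.
apply: (@le_trans _ _ (m ((E `\` \bigcup_n F n) `|` (G `&` \bigcup_n F n)))).
  apply: (@le_measure _ _ _ m); rewrite ?inE //.
    by apply: measurableU; [exact: measurableD|exact: measurableI].
  by move=> x /[dup] /GE Ex Gx; have [] := pselect ((\bigcup_n F n) x); rewrite /=; tauto.
apply: le_trans (measureU2 _ _ _) _; [exact: measurableD|exact: measurableI|].
rewrite [X in (X + _)%E](_ : _ = 0%E); last first.
  by apply: wmeasure_null => //; exact: measurableD.
rewrite add0e setI_bigcupr.
have mGF n : measurable (G `&` F n) by exact: measurableI.
have -> : m (\bigcup_n F n) = (\sum_(n <oo) m (F n))%E.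
  exact: measure_bigcupT.
apply: (@le_trans _ _ (\sum_(n <oo) m (G `&` F n))%E).
  by rewrite -measure_bigcupT //; exact: trivIset_setIl.
rewrite -nneseriesZl //; apply: lee_nneseries => // n _.
have [->|[Q' [rQ' FQ' Q'F hd hu]]] := hF n; first by rewrite setI0 !measure0 mule0.
have mQ' := measurable_rectangle rQ'.
have wF : m Q' = m (F n).
  rewrite -(setDUK FQ') measureU //; last by rewrite setDE setICA setICr setI0.
  - by rewrite [X in (_ + X)%E]wmeasure_null ?adde0 //; exact: measurableD.
  - exact: measurableD.
have muF : mu Q' = mu (F n).
  have -> : mu Q' = (mu (F n) + mu (Q' `\` F n))%E.
    rewrite -[in LHS](setDUK FQ'); apply: measureU => //; first exact: measurableD.
    by rewrite setDE setICA setICr setI0.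
  by rewrite Q'F adde0.
have [r' r'0 muQ'] := lebesgue2_rectangle rQ'.
(* The densities 1/4 and 1/8 do not add up to 1. *)
have [x [Fx Ex hx]] : exists x, [/\ F n x, ~ E x & normc (f x - c Q') <= lam].
  apply: contrapT => nex.
  have : (mu (F n) <= mu (E `&` F n) +
      mu (Q' `&` [set x | (lam < normc (f x - c Q'))%R]))%E.
    apply: le_trans (measureU2 _ _ _); [|exact: measurableI..].
    apply: le_measure; rewrite ?inE //.
      by apply: measurableU; exact: measurableI.
    move=> y Fy; have [Ey|nEy] := pselect (E y); first by left.
    right; split; first exact: FQ'.
    by rewrite /= ltNge; apply/negP => hy; apply: nex; exists y.
  move=> /le_trans /(_ (leeD hu (hf _ rQ'))).
  rewrite -muF muQ' jn_densityE -!EFinM -EFinD lee_fin leNgt.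
  by rewrite level_sets_miss_a_point.
have cc : normc (c Q - c Q') <= 2 * lam.
  have h1 : normc (f x - c Q) <= lam.
    rewrite leNgt; apply/negP => h; apply: Ex; split => //; apply: FQ; exists n => //.
  apply: le_trans (le_normc_sub _ (f x) _) _.
  by rewrite normc_distC mulrDl !mul1r lerD.
rewrite -wF; apply: le_trans (IH _ rQ').
apply: (@le_measure _ _ _ m); rewrite ?inE; [exact: measurableI..|].
move=> y [[Qy hy] Fy]; split; first exact: FQ'.
rewrite /=; have := le_normc_sub (f y) (c Q') (c Q).
rewrite [X in _ <= _ + X]normc_distC => tri; rewrite -(ltrD2r (2 * lam)).
apply: (@lt_le_trans _ _ (normc (f y - c Q))).
  by move: hy; rewrite /= -natr1 mulrDl mul1r.
by apply: le_trans tri _; rewrite lerD2l.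
Qed.

End weights.

(** * Oscillations of any order *)

(** This is [t <= expR t] at [t = a * z / q], raised to the power [q]. *)
Lemma powR_le_expR (R : realType) (q a z : R) : 0 < q -> 0 < a -> 0 <= z ->
  z `^ q <= (q / a) `^ q * expR (a * z).
Proof.
move=> q0 a0 z0; have -> : a * z = (a * z / q) * q by field; rewrite gt_eqF.
have qa0 : 0 <= q / a by rewrite divr_ge0 ?(ltW q0) ?(ltW a0).
rewrite expRM -powRM ?expR_ge0 //.
have -> : z = q / a * (a * z / q) by field; rewrite !gt_eqF.
have -> : a * (q / a * (a * z / q)) / q = a * z / q by field; rewrite !gt_eqF.
set t := a * z / q; have t0 : 0 <= t by rewrite divr_ge0 ?mulr_ge0 ?(ltW a0) ?(ltW q0).
apply: ge0_ler_powR; rewrite ?nnegrE ?(mulr_ge0 qa0) ?expR_ge0 ?(ltW q0) //.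
by rewrite ler_wpM2l // (le_trans _ (expR_ge1Dx _)) // lerDr.
Qed.

Lemma geometric_nneseries_le (R : realType) (a r : R) : 0 <= a -> 0 <= r < 1 ->
  (\sum_(k <oo) (a * r ^+ k)%:E <= (a / (1 - r))%:E)%E.
Proof.
move=> a0 /andP[r0 r1]; apply: lime_le.
  by apply: is_cvg_nneseries => k _ _; rewrite lee_fin mulr_ge0 ?exprn_ge0.
apply: nearW => n; rewrite sumEFin lee_fin.
have -> : \sum_(0 <= i < n) a * r ^+ i = series (geometric a r) n by [].
rewrite geometric_seriesE ?lt_eqF //= ler_pM2r ?invr_gt0 ?subr_gt0 //.
by rewrite ler_piMr // gerBl exprn_ge0.
Qed.

Section power.
Context (R : realType) (n1 n2 : nat).
Local Notation X := (euclid2 R n1 n2).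
Local Notation mu := (lebesgue2 R n1 n2).
Local Notation rect := (rectangle R n1 n2).

(** In units of [2 * lam], the level sets of the oscillation decay like [b ^+ k].
    Powers are dominated by [expR (a * z)] for any [a > 0], and [a = 1 - b] makes
    the series of the layers geometric with ratio [expR a * b < 1]. *)
Lemma john_nirenberg_power (w : X -> R) (q : R) : uniform_weight w -> 0 < q ->
  exists2 C : R, 0 < C &
    forall (f : X -> R[i]) (c : set X -> R[i]) (lam : R), cmeasurable f -> 0 < lam ->
    (forall Q, rect Q ->
      mu (Q `&` [set x | (lam < normc (f x - c Q))%R]) <= (jn_density R n1 n2)%:E * mu Q)%E ->
    forall Q, rect Q ->
      (\int[mu]_(x in Q) (normc (f x - c Q) `^ q * w x)%:E <=
        (C * lam `^ q)%:E * wmeas w Q)%E.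
Proof.
move=> uw q0; have [b /andP[b0 b1] hb] := john_nirenberg uw.
have [w0 mw wQ _] := uw.
pose a := 1 - b; have a0 : 0 < a by rewrite subr_gt0.
pose r := expR a * b.
have r0 : 0 <= r by rewrite mulr_ge0 // expR_ge0.
have r1 : r < 1.
  have : b < expR (- a).
    rewrite (le_lt_trans _ (expR_gt1Dx _)) ?oppr_eq0 ?gt_eqF // /a; lra.
  by rewrite expRN -[X in _ < X]mulr1 ltr_pdivlMl ?expR_gt0.
pose K := (q / a) `^ q * expR a.
have K0 : 0 < K by rewrite mulr_gt0 ?expR_gt0 // powR_gt0 // divr_gt0.
exists (2 `^ q * (K / (1 - r))).
  by rewrite mulr_gt0 ?powR_gt0 // divr_gt0 // subr_gt0.
move=> f c lam mf lam0 hf Q rQ; have mQ := measurable_rectangle rQ.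
have {}hb := hb f c lam mf (ltW lam0) hf.
pose h x := normc (f x - c Q).
have h0 x : 0 <= h x by exact: normc_ge0.
have mh : measurable_fun setT h by exact: measurable_normc.
pose G k := [set x | k%:R * (2 * lam) < h x].
have mG k : measurable (G k) by exact: measurable_normc_gt.
have l2 : 0 < 2 * lam by rewrite mulr_gt0.
pose B k : R := (2 * lam) `^ q * (K * expR a ^+ k).
have B0 k : 0 <= B k.
  by rewrite /B mulr_ge0 ?powR_ge0 // mulr_ge0 ?(ltW K0) // exprn_ge0 ?expR_ge0.
pose u k x := ((B k)%:E * ((EFin \o w) \_ (G k)) x)%E.
have wG0 k x : (0 <= ((EFin \o w) \_ (G k)) x)%E.
  by apply: erestrict_ge0 => y _; rewrite lee_fin.
have u0 k x : (0 <= u k x)%E by rewrite mule_ge0 ?lee_fin.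
have mwG k : measurable_fun Q ((EFin \o w) \_ (G k)).
  apply: measurable_funTS; apply/(measurable_restrictT (EFin \o w) (mG k)).1.
  by apply/measurable_EFinP; exact: measurable_funTS.
have mu_ k : measurable_fun Q (u k) by apply: measurable_funeM.
apply: (@le_trans _ _ (\int[mu]_(x in Q) \sum_(k <oo) u k x)%E).
  apply: ge0_le_integral.
  - exact: mQ.
  - by move=> x _; rewrite lee_fin mulr_ge0 ?powR_ge0.
  - apply/measurable_EFinP; apply: measurable_funTS.
    exact: (measurable_funM (measurableT_comp (measurable_powR q) mh) mw).
  - exact: (ge0_emeasurable_sum (P := xpredT) (fun k x _ _ => u0 k x) (fun k _ => mu_ k)).
  move=> x _; have [hx0|hx0] := leP (h x) 0.
    have -> : normc (f x - c Q) = 0 by apply/eqP; rewrite eq_le hx0 h0.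
    by rewrite powR0 ?gt_eqF // mul0r; apply: nneseries_ge0.
  pose z := h x / (2 * lam); have z0 : 0 < z by rewrite divr_gt0.
  have exn : exists n, z <= n%:R.
    by exists (Num.bound z); rewrite ltW // archi_boundP // ltW.
  case: (ex_minnP exn) => -[|k] zk kmin; first by rewrite leNgt z0 in zk.
  have kz : k%:R < z.
    by rewrite ltNge; apply/negP => /kmin; rewrite ltnn.
  have Gk : G k x by rewrite /G /= -ltr_pdivlMr.
  apply: (@le_trans _ _ (u k x)); last first.
    apply: le_trans (nneseries_lim_ge k.+1 _); last by move=> n _ _; exact: u0.
    by rewrite big_nat_recr //= leeDr // sume_ge0.
  rewrite /u /patch mem_set //= -EFinM lee_fin ler_wpM2r //.
  have -> : normc (f x - c Q) = (2 * lam) * z by rewrite /z mulrC divfK ?gt_eqF.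
  rewrite powRM ?(ltW l2) ?(ltW z0) // /B ler_wpM2l ?powR_ge0 //.
  apply: le_trans (powR_le_expR q0 a0 (ltW z0)) _.
  rewrite /K -mulrA ler_wpM2l ?powR_ge0 // -exprS -expRM_natr ler_expR.
  by rewrite ler_wpM2l // ltW.
rewrite integral_nneseries //.
have [W W0] : exists2 W : R, 0 <= W & wmeas w Q = W%:E.
  have [h1 h2] := andP (wQ _ rQ); exists (fine (wmeas w Q)).
    by rewrite fine_ge0 // ltW.
  by rewrite fineK // ge0_fin_numE // ltW.
move=> WQ.
apply: (@le_trans _ _ (\sum_(k <oo) ((2 * lam) `^ q * K * W * r ^+ k)%:E)%E).
  apply: lee_nneseries => k _; first by move=> _; apply: integral_ge0 => x _; exact: u0.
  rewrite /u ge0_integralZl_EFin // -integral_mkcondr.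
  apply: (@le_trans _ _ ((B k)%:E * ((b ^+ k)%:E * wmeas w Q))%E).
    by rewrite lee_wpmul2l ?lee_fin //; exact: hb.
  by rewrite WQ -!EFinM lee_fin /B /r exprMn le_eqVlt; apply/orP; left; apply/eqP; ring.
apply: le_trans (geometric_nneseries_le _ _) _.
- by rewrite !mulr_ge0 ?powR_ge0 ?(ltW K0).
- by rewrite r0.
rewrite WQ -EFinM lee_fin powRM ?(ltW lam0) // le_eqVlt; apply/orP; left; apply/eqP.
by field; rewrite subr_eq0 gt_eqF.
Qed.

End power.

(** * A_infinity weights *)

Section large_rectangles.
Context (R : realType) (n1 n2 : nat).
Local Notation X := (euclid2 R n1 n2).

Definition big_rectangle k : set X :=
  crect ([tuple - k.+1%:R | i < n1], [tuple - k.+1%:R | i < n2]) (k.+1%:R *+ 2, k.+1%:R *+ 2).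

Lemma big_rectangleE k : big_rectangle k = [set x : X |
  (forall i, `|tnth x.1 i| <= k.+1%:R) /\ (forall i, `|tnth x.2 i| <= k.+1%:R)].
Proof.
apply/seteqP; split=> x [h1 h2]; split=> i; [have := h1 i|have := h2 i|have := h1 i|have := h2 i];
  by rewrite /= ?in_itv /= !tnth_mktuple ler_norml mulr2n addKr.
Qed.

Lemma rectangle_big_rectangle k : rectangle R n1 n2 (big_rectangle k).
Proof. by apply/rectangleP; do 2 eexists; split; [| |reflexivity]; rewrite /= mulrn_wgt0. Qed.

Lemma big_rectangle_exhaust (x : X) : exists k0, forall k, (k0 <= k)%N -> big_rectangle k x.
Proof.
pose S := \sum_i `|tnth x.1 i| + \sum_i `|tnth x.2 i|.
have S0 : 0 <= S by rewrite addr_ge0 // sumr_ge0.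
exists (Num.bound S) => k hk; rewrite big_rectangleE.
have Sk : S <= k.+1%:R.
  rewrite (le_trans (ltW (archi_boundP S0))) // ler_nat ltnW //.
split=> i; apply: le_trans Sk; rewrite /S (bigD1 i) //=.
  by rewrite -addrA lerDl addr_ge0 ?sumr_ge0.
by rewrite addrCA lerDl addr_ge0 ?sumr_ge0.
Qed.

Lemma rectangle_sub_big_rectangle Q : rectangle R n1 n2 Q ->
  exists k0, forall k, (k0 <= k)%N -> Q `<=` big_rectangle k.
Proof.
move=> /rectangleP[c [s [s1 s2 ->]]].
have [k1 h1] := big_rectangle_exhaust (c : X).
have [k2 h2] := big_rectangle_exhaust
  (([tuple tnth c.1 i + s.1 | i < n1], [tuple tnth c.2 i + s.2 | i < n2]) : X).
exists (maxn k1 k2) => k; rewrite geq_max => /andP[/h1 + /h2].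
rewrite !big_rectangleE => -[a1 a2] [b1 b2] x [x1 x2].
split=> i; [have := x1 i; have := a1 i; have := b1 i|have := x2 i; have := a2 i; have := b2 i];
  rewrite /= !tnth_mktuple in_itv /= !ler_norml => /andP[_ h] /andP[h' _] /andP[h3 h4];
  by rewrite (le_trans h' h3) (le_trans h4 h).
Qed.

Lemma bigcup_big_rectangle : \bigcup_k big_rectangle k = setT.
Proof.
apply/seteqP; split=> // x _; have [k h] := big_rectangle_exhaust x.
by exists k => //; exact: h.
Qed.

End large_rectangles.

Section Ainfty_uniform.
Context (R : realType) (n1 n2 : nat).
Local Notation X := (euclid2 R n1 n2).
Local Notation mu := (lebesgue2 R n1 n2).
Local Notation rect := (rectangle R n1 n2).

Lemma wmeas1 (A : set X) : measurable A -> wmeas (fun=> 1) A = mu A.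
Proof. by move=> mA; rewrite /wmeas integral_cst // mul1e. Qed.

Lemma uniform_weight1 : uniform_weight (fun=> 1 : R) (n1 := n1) (n2 := n2).
Proof.
split=> //.
  move=> Q rQ; rewrite wmeas1; last exact: measurable_rectangle.
  by have [r r0 /= ->] := lebesgue2_rectangle rQ; rewrite lte_fin r0 ltry.
move=> a a0; exists a => // Q E rQ mE _.
by rewrite !wmeas1 //; exact: measurable_rectangle.
Qed.

Lemma weighted_chebyshev (w g : X -> R) t Q : (forall x, 0 <= w x) -> measurable_fun setT w ->
  measurable Q -> measurable_fun setT g -> (forall x, 0 <= g x) -> 0 <= t ->
  (t%:E * wmeas w (Q `&` [set x | t <= g x]%R) <= \int[mu]_(x in Q) (g x * w x)%:E)%E.
Proof.
move=> w0 mw mQ mg g0 t0.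
have mG : measurable (Q `&` [set x | t <= g x]).
  apply: measurableI => //; have := measurable_fun_ler (measurable_cst t) mg.
  by move=> /(_ measurableT [set true]); rewrite setTI; apply.
have mW D : measurable_fun D (EFin \o w).
  by apply/measurable_EFinP; exact: measurable_funTS.
have mgw D : measurable_fun D (fun x => (g x * w x)%:E).
  by apply/measurable_EFinP; apply: measurable_funTS; exact: measurable_funM.
rewrite /wmeas -ge0_integralZl_EFin //; last by move=> x _; rewrite lee_fin.
apply: (@le_trans _ _ (\int[mu]_(x in Q `&` [set x | t <= g x]%R) (g x * w x)%:E)%E).
  apply: ge0_le_integral.
  - exact: mG.
  - by move=> x _; rewrite mule_ge0 // lee_fin.
  - exact: (measurable_funeM _ (mW _)).
  - exact: mgw.
  - by move=> x [_ tg]; rewrite -EFinM lee_fin ler_wpM2r.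
apply: ge0_subset_integral => //.
by move=> x _; rewrite lee_fin mulr_ge0.
Qed.

(** Let [g = w^(-p'/p)], whose mean over [Q] is controlled by the A_p condition.
    By Chebyshev's inequality [g] is at most a multiple [t] of that mean except on
    a set [H] filling at most [a / 2] of [Q], so that [w] is at least a fixed multiple
    [eta] of its own mean on half of [E]. This estimate also yields the
    positivity of [w] on rectangles: if [w Q = 0] then [w] has zero mass on every
    larger rectangle, hence vanishes almost everywhere. *)
Lemma Ainfty_uniform (w : X -> R) : Ainfty w -> uniform_weight w.
Proof.
move=> [p p1 [w0 wne wint wsup]].
set s : R := (p / (p - 1) / p) in wsup.
have p10 : 0 < p - 1 by rewrite subr_gt0.
have p0 : 0 < p by lra.
have sE : s = (p - 1)^-1 by rewrite /s; field; rewrite !gt_eqF.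
have s0 : 0 < s by rewrite sE invr_gt0.
have pp : p / (p / (p - 1)) = s^-1 by rewrite sE; field; rewrite !gt_eqF.
rewrite pp in wsup.
have [M M0 hM] : exists2 M : R, 0 < M & forall Q, rect Q ->
   (((mu Q)^-1 * \int[mu]_(x in Q) (w x)%:E) *
             ((mu Q)^-1 * \int[mu]_(x in Q) ((w x)%:E `^ s)^-1)
               `^ s^-1 <= M%:E)%E.
  move: wsup; set S := ereal_sup _ => wsup.
  exists (`|fine S| + 1); first by rewrite ltr_wpDl.
  move=> Q rQ; apply: (@le_trans _ _ S); first by apply: ereal_sup_ubound; exists Q.
  case: S wsup => [r||] //= _; last by rewrite leNye.
  by rewrite lee_fin (le_trans (ler_norm _)) // lerDl.
have mw : measurable_fun setT w.
  rewrite -(bigcup_big_rectangle R n1 n2).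
  have mB k := measurable_rectangle (rectangle_big_rectangle R n1 n2 k).
  apply/(measurable_fun_bigcup _ mB) => k.
  have /integrableP[/measurable_EFinP] := wint _ (rectangle_big_rectangle R n1 n2 k).
  by [].
have wfin Q : rect Q -> (0 <= wmeas w Q < +oo)%E.
  move=> rQ; rewrite integral_ge0 /=; last by move=> x _; rewrite lee_fin.
  have /integrableP[_] := wint _ rQ; apply: le_lt_trans; rewrite le_eqVlt; apply/orP; left.
  by apply/eqP; apply: eq_integral => x _; rewrite /= ger0_norm.
pose m : {measure set X -> \bar R} := wmeasure w0 mw.
have mW (D : set X) : measurable_fun D (EFin \o w).
  by apply/measurable_EFinP; exact: measurable_funTS.
have hw a : 0 < a -> exists2 eta : R, 0 < eta &
        forall Q E, rect Q -> measurable E -> E `<=` Q ->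
          (a%:E * mu Q <= mu E -> eta%:E * wmeas w Q <= wmeas w E)%E.
  move=> a0; pose eta := (a / 2) `^ s^-1 * (a / 2) / M.
  have a20 : 0 < a / 2 by rewrite divr_gt0.
  exists eta; first by rewrite divr_gt0 // mulr_gt0 // powR_gt0.
  move=> Q E rQ mE EQ aQE; have mQ := measurable_rectangle rQ.
  have [W0 Woo] := andP (wfin _ rQ).
  have wE0 : (0 <= wmeas w E)%E by apply: integral_ge0 => x _; rewrite lee_fin.
  have [W0'|W0'] := eqVneq (wmeas w Q) 0%E; first by rewrite W0' mule0.
  have [W WQ W'0] : exists2 W : R, wmeas w Q = W%:E & 0 < W.
    exists (fine (wmeas w Q)); first by rewrite fineK // ge0_fin_numE.
    by rewrite fine_gt0 // lt_neqAle eq_sym W0' W0 Woo.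
  have [r r0 muQ] := lebesgue2_rectangle rQ.
  pose g x := (((w x)%:E `^ s)^-1)%E.
  have g0 x : (0 <= g x)%E by rewrite inve_ge0 poweR_ge0.
  have gE x : g x = if w x == 0 then +oo%E else (w x `^ (- s))%:E.
    rewrite /g poweR_EFin inver powR_eq0 (gt_eqF s0) /= andbT powRN.
    by case: ifP.
  have mg : measurable_fun setT g.
    rewrite (_ : g = fun x => if w x == 0 then +oo%E else (w x `^ (- s))%:E).
      apply: measurable_fun_ifT; [exact: measurable_fun_eqr|exact: measurable_cst|].
      by apply/measurable_EFinP; exact: (measurableT_comp (measurable_powR (- s)) mw).
    exact/funext.
  (* the bound that the A_p condition gives for the mean of g over Q *)
  pose A := (M * r / W) `^ s.
  have A0 : 0 < A by rewrite powR_gt0 // divr_gt0 // mulr_gt0.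
  have hB : (\int[mu]_(x in Q) g x <= (A * r)%:E)%E.
    have := hM _ rQ; rewrite -/(wmeas w Q) WQ.
    have : (0 <= \int[mu]_(x in Q) g x)%E by apply: integral_ge0 => x _; exact: g0.
    have -> : (mu Q)^-1%E = r^-1%:E by have /= -> := muQ; rewrite inver gt_eqF.
    case: (\int[mu]_(x in Q) g x)%E => [B||] //.
      rewrite lee_fin => B0; rewrite -[in X in poweR X _]EFinM poweR_EFin -!EFinM !lee_fin => h.
      rewrite -ler_pdivrMr // /A.
      have -> : B / r = ((r^-1 * B) `^ s^-1) `^ s.
        by rewrite -powRrM mulVf ?gt_eqF // powRr1 ?mulr_ge0 ?invr_ge0 ?(ltW r0) // mulrC.
      apply: ge0_ler_powR; rewrite ?nnegrE ?powR_ge0 ?(ltW s0) //.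
        by rewrite divr_ge0 ?mulr_ge0 ?(ltW M0) ?(ltW r0) ?(ltW W'0).
      rewrite ler_pdivlMr // -ler_pdivrMr //.
      by rewrite (_ : _ * W / r = r^-1 * W * (r^-1 * B) `^ s^-1) //; ring.
    rewrite gt0_muley ?lte_fin ?invr_gt0 // poweRyr ?gt_eqF ?invr_gt0 //.
    by rewrite -EFinM gt0_muley ?lte_fin ?mulr_gt0 ?invr_gt0.
  pose t := 2 * A / a; have t0 : 0 < t by rewrite divr_gt0 // mulr_gt0.
  pose H := Q `&` [set x | (t%:E <= g x)%E].
  have mH : measurable H.
    apply: measurableI => //; rewrite -[X in measurable X]setTI.
    exact: emeasurable_fun_c_infty.
  have muH : (mu H <= (a / 2 * r)%:E)%E.
    have := le_integral_abse mu mQ (measurable_funTS mg) t0.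
    have -> : Q `&` [set x | (t%:E <= `|g x|)%E] = H.
      by apply/seteqP; split=> x /= [? h]; split => //; move: h; rewrite /= gee0_abs.
    have -> : (\int[mu]_(x in Q) `|g x| = \int[mu]_(x in Q) g x)%E.
      by apply: eq_integral => x _; rewrite gee0_abs.
    move=> /le_trans /(_ hB); rewrite -lee_pdivlMl // -EFinM.
    have -> // : t^-1 * (A * r) = a / 2 * r.
    by rewrite /t; field; rewrite !gt_eqF.
  pose F := E `\` H; have mF : measurable F by exact: measurableD.
  have muF : ((a / 2 * r)%:E <= mu F)%E.
    have : (mu E <= mu F + mu H)%E.
      apply: le_trans (measureU2 _ _ _) => //.
      apply: le_measure; rewrite ?inE //; first exact: measurableU.
      by move=> x Ex; have [?|?] := pselect (H x); [right|left].
    move=> /(le_trans aQE) /le_trans /(_ (leeD2l _ muH)).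
    have Foo : mu F \is a fin_num.
      rewrite ge0_fin_numE // (@le_lt_trans _ _ (mu Q)) //.
        by apply: le_measure; rewrite ?inE // => x [/EQ].
      by have /= -> := muQ; rewrite ltry.
    rewrite muQ -(fineK Foo) -!EFinM -EFinD !lee_fin => h.
    rewrite -(lerD2r (a / 2 * r)) (le_trans _ h) //.
    by rewrite -mulrDl -splitr.
  pose y := (t^-1) `^ s^-1.
  have y0 : 0 < y by rewrite powR_gt0 // invr_gt0.
  have yw x : F x -> y <= w x.
    move=> [Ex nH]; rewrite leNgt; apply/negP => wy; apply: nH; split; first exact: EQ.
    rewrite /= gE; case: ifPn => [_|wx0]; first by rewrite leey.
    have wx : 0 < w x by rewrite lt_neqAle eq_sym wx0 w0.
    rewrite lee_fin powRN -[t]invrK lef_pV2 ?posrE ?powR_gt0 ?invr_gt0 //.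
    have -> : t^-1 = y `^ s by rewrite /y -powRrM mulVf ?gt_eqF // powRr1 // invr_ge0 ltW.
    by apply: ge0_ler_powR; rewrite ?nnegrE ?(ltW s0) ?(ltW y0) ?(ltW wy).
  apply: (@le_trans _ _ (y%:E * mu F)%E).
    apply: (@le_trans _ _ (y%:E * (a / 2 * r)%:E)%E); last first.
      by rewrite lee_wpmul2l // lee_fin ltW.
    rewrite WQ -!EFinM lee_fin /eta /y.
    have -> : t^-1 = (a / 2) * A^-1 by rewrite /t; field; rewrite !gt_eqF.
    have MrW0 : 0 <= M * r / W by rewrite divr_ge0 ?mulr_ge0 ?(ltW M0) ?(ltW r0) ?(ltW W'0).
    have AV : (A^-1) `^ s^-1 = W / (M * r).
      rewrite -(powR_inv1 (ltW A0)) /A -!powRrM.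
      rewrite (_ : s * (-1 * s^-1) = -1); last by field; rewrite gt_eqF.
      by rewrite powR_inv1 // invf_div.
    rewrite (@powRM _ (a / 2) A^-1) ?(ltW a20) ?invr_ge0 ?(ltW A0) // AV.
    by rewrite le_eqVlt; apply/orP; left; apply/eqP; field; rewrite !gt_eqF.
  apply: (@le_trans _ _ (m F)); last by apply: le_measure; rewrite ?inE // => x [].
  rewrite -integral_cst //; apply: ge0_le_integral => //.
  by move=> x _; rewrite lee_fin ltW.
split=> // Q rQ; have [W0 Woo] := andP (wfin _ rQ); rewrite Woo andbT lt_neqAle W0 andbT.
apply/negP => /eqP WQ; apply: wne.
have mQ := measurable_rectangle rQ.
have [k0 hk0] := rectangle_sub_big_rectangle rQ.
have [r r0 muQ] := lebesgue2_rectangle rQ.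
have wB k : {ae mu, forall x, @big_rectangle R n1 n2 (maxn k k0) x -> w x = 0}.
  set B := @big_rectangle _ _ _ _.
  have rB : rect B by exact: rectangle_big_rectangle.
  have mB := measurable_rectangle rB.
  have [r' r'0 muB] := lebesgue2_rectangle rB.
  have [|eta eta0 heta] := hw (r / r'); first by rewrite divr_gt0.
  have QB : Q `<=` B by apply: hk0; exact: leq_maxr.
  have := heta _ _ rB mQ QB; rewrite muB muQ -EFinM divfK ?gt_eqF // => /(_ (lexx _)).
  rewrite -WQ => wB.
  have wB0 : wmeas w B = 0%E.
    apply/eqP; rewrite eq_le; have [-> _] := andP (wfin _ rB); rewrite andbT.
    by rewrite -(@lee_pmul2l _ eta%:E) ?lte_fin // mule0.
  have : (\int[mu]_(x in B) `|(w x)%:E| = 0)%E.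
    rewrite -wB0; apply: eq_integral => x _.
    by rewrite gee0_abs // lee_fin.
  move=> /(ae_eq_integral_abs mu mB (mW B)).
  by apply: filterS => x h /h [].
have := ae_foralln wB; apply: filterS => x h.
have [k hk] := big_rectangle_exhaust x.
by apply: (h k); apply: hk; exact: leq_maxl.
Qed.

End Ainfty_uniform.

(** * Changing the constant in an oscillation *)

Section oscillation.
Context (R : realType) (n1 n2 : nat).
Local Notation X := (euclid2 R n1 n2).
Local Notation mu := (lebesgue2 R n1 n2).
Local Notation rect := (rectangle R n1 n2).
Implicit Types (w v : X -> R) (f : X -> R[i]).

Lemma norm_Re_le_normc (z : R[i]) : `|complex.Re z| <= normc z.
Proof.
case: z => a b /=; rewrite -sqrtr_sqr ler_sqrt ?addr_ge0 ?sqr_ge0 //.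
by rewrite lerDl sqr_ge0.
Qed.

Lemma norm_Im_le_normc (z : R[i]) : `|complex.Im z| <= normc z.
Proof.
case: z => a b /=; rewrite -sqrtr_sqr ler_sqrt ?addr_ge0 ?sqr_ge0 //.
by rewrite lerDr sqr_ge0.
Qed.

Lemma normc_le_ReIm (z : R[i]) : normc z <= `|complex.Re z| + `|complex.Im z|.
Proof.
case: z => a b /=; rewrite -[leRHS]ger0_norm ?addr_ge0 // -sqrtr_sqr ler_sqrt ?sqr_ge0 //.
rewrite sqrrD !real_normK ?num_real // -addrA lerD2l lerDr.
by rewrite mulrn_wge0 // mulr_ge0.
Qed.

Lemma real_mean_close w (h g : X -> R) (c L : R) Q : uniform_weight w -> rect Q ->
  measurable_fun setT h -> measurable_fun setT g -> (forall x, `|h x - c| <= g x) ->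
  (\int[mu]_(x in Q) (g x * w x)%:E <= L%:E * wmeas w Q)%E ->
  `|(fine (wmeas w Q))^-1 * (\int[mu]_(x in Q) (h x * w x)) - c| <= L.
Proof.
move=> [w0 mw wQ _] rQ mh mg hg hL; have mQ := measurable_rectangle rQ.
have [W1 W2] := andP (wQ _ rQ).
have [W W0 WQ] : exists2 W : R, 0 < W & wmeas w Q = W%:E.
  exists (fine (wmeas w Q)); first by rewrite fine_gt0 // W1 W2.
  by rewrite fineK // ge0_fin_numE // ltW.
rewrite WQ /=.
have g0 x : 0 <= g x by rewrite (le_trans _ (hg x)).
have mE (k : X -> R) : measurable_fun setT k -> measurable_fun Q (EFin \o k).
  by move=> mk; apply/measurable_EFinP; exact: measurable_funTS.
have iw : mu.-integrable Q (EFin \o w).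
  apply/integrableP; split; first exact: mE.
  by under eq_integral => x _ do rewrite /= ger0_norm //.
have mgw : measurable_fun setT (fun x => g x * w x) by exact: measurable_funM.
have igw : mu.-integrable Q (EFin \o (fun x => g x * w x)).
  apply/integrableP; split; first exact: mE.
  apply: (@le_lt_trans _ _ (L%:E * wmeas w Q)%E); last by rewrite WQ -EFinM ltry.
  apply: le_trans hL; rewrite le_eqVlt; apply/orP; left; apply/eqP.
  by apply: eq_integral => x _; rewrite /= ger0_norm // mulr_ge0.
have mhcw : measurable_fun setT (fun x => (h x - c) * w x).
  exact: (measurable_funM (measurable_funB mh (measurable_cst c)) mw).
have ihcw : mu.-integrable Q (EFin \o (fun x => (h x - c) * w x)).
  apply: (le_integrable mQ _ _ igw); first exact: mE.
  move=> x _ /=; rewrite lee_fin !normrM (ger0_norm (w0 x)) (ger0_norm (g0 x)).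
  by rewrite ler_wpM2r.
have icw : mu.-integrable Q (EFin \o (fun x => c * w x)).
  exact: (@integrableZl _ _ _ mu Q mQ c (EFin \o w) iw).
have -> : \int[mu]_(x in Q) (h x * w x) = \int[mu]_(x in Q) ((h x - c) * w x) + c * W.
  rewrite -[W]/(fine W%:E) -WQ /wmeas -/(Rintegral mu Q w) -RintegralZl // -RintegralD //.
  by apply: eq_Rintegral => x _; ring.
rewrite mulrDr [W^-1 * (c * W)]mulrCA mulVf ?gt_eqF // mulr1 addrK.
rewrite normrM gtr0_norm ?invr_gt0 // ler_pdivrMl //.
apply: le_trans (le_normr_Rintegral mQ ihcw) _.
have : (\int[mu]_(x in Q) `|((h x - c) * w x)%:E| <= (W * L)%:E)%E.
  apply: le_trans (_ : (_ <= \int[mu]_(x in Q) (g x * w x)%:E)%E) _.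
    apply: ge0_le_integral.
    - exact: mQ.
    - by [].
    - by apply/measurable_EFinP; apply: measurable_funTS; exact: measurableT_comp.
    - exact: (mE (fun x => g x * w x)).
    - move=> x _; rewrite lee_fin normrM (ger0_norm (w0 x)).
      by rewrite ler_wpM2r.
  by rewrite mulrC EFinM -WQ.
have i0 : (0 <= \int[mu]_(x in Q) `|((h x - c) * w x)%:E|)%E.
  by apply: integral_ge0.
rewrite /Rintegral -[X in _ -> _ <= X]/(fine (W * L)%:E) => le1.
by apply: fine_le => //; rewrite ge0_fin_numE // (le_lt_trans le1) // ltry.
Qed.

(** A weighted mean of [f] is as close to [c] as [f] is in mean; applied to real
    and imaginary parts separately, whence the factor 2. *)
Lemma wmean_close w f c L Q : uniform_weight w -> rect Q -> cmeasurable f ->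
  (\int[mu]_(x in Q) (normc (f x - c) * w x)%:E <= L%:E * wmeas w Q)%E ->
  normc (wmean w f Q - c) <= 2 * L.
Proof.
move=> uw rQ mf hL; apply: le_trans (normc_le_ReIm _) _.
have mn : measurable_fun setT (fun x => normc (f x - c)) by exact: measurable_normc.
have hRe := real_mean_close (c := complex.Re c) uw rQ mf.1 mn _ hL.
have hIm := real_mean_close (c := complex.Im c) uw rQ mf.2 mn _ hL.
rewrite mulrDl mul1r lerD //.
- apply: le_trans (hRe _); last first.
    by move=> x; apply: le_trans (norm_Re_le_normc _); case: (f x) (c) => ? ? [].
  rewrite le_eqVlt; apply/orP; left; apply/eqP; congr (`|_|).
  have -> : \int[mu]_(x in Q) (complex.Re (f x) * w x) =
      \int[mu]_(x in Q) (complex.Re (f x * (w x)%:C)%C).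
    by apply: eq_Rintegral => x _; case: (f x) => ? ? /=; rewrite mulr0 subr0.
  rewrite /wmean /cintegral; case: (c) => c1 c2 /=; congr (_ - _).
  by rewrite mul0r subr0.
- apply: le_trans (hIm _); last first.
    by move=> x; apply: le_trans (norm_Im_le_normc _); case: (f x) (c) => ? ? [].
  rewrite le_eqVlt; apply/orP; left; apply/eqP; congr (`|_|).
  have -> : \int[mu]_(x in Q) (complex.Im (f x) * w x) =
      \int[mu]_(x in Q) (complex.Im (f x * (w x)%:C)%C).
    by apply: eq_Rintegral => x _; case: (f x) => ? ? /=; rewrite mulr0 add0r.
  rewrite /wmean /cintegral; case: (c) => c1 c2 /=; congr (_ - _).
  by rewrite mul0r addr0.
Qed.

Lemma average_wmean f Q : rect Q -> average f Q = wmean (fun=> 1) f Q.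
Proof.
move=> rQ; rewrite /average /wmean (wmeas1 (measurable_rectangle rQ)); congr (_ * cintegral _ _).
by apply/funext => x; rewrite mulr1.
Qed.

Lemma le_powR_add (a b q : R) : 0 <= a -> 0 <= b -> 0 < q ->
  (a + b) `^ q <= 2 `^ q * (a `^ q + b `^ q).
Proof.
move=> a0 b0 q0.
apply: (@le_trans _ _ ((2 * Num.max a b) `^ q)).
  apply: ge0_ler_powR; rewrite ?nnegrE ?(ltW q0) ?addr_ge0 ?mulr_ge0 ?le_max ?a0 //.
  by rewrite mulrDl mul1r lerD // le_max lexx ?orbT.
rewrite powRM ?le_max ?a0 // ler_wpM2l ?powR_ge0 //.
by case: (leP a b) => _; rewrite ?lerDl ?lerDr powR_ge0.
Qed.

Lemma recenter w f c d q A D Q : uniform_weight w -> rect Q -> cmeasurable f -> 0 < q ->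
  (\int[mu]_(x in Q) (normc (f x - c) `^ q * w x)%:E <= A%:E * wmeas w Q)%E ->
  normc (c - d) <= D ->
  (\int[mu]_(x in Q) (normc (f x - d) `^ q * w x)%:E <=
     (2 `^ q * (A + D `^ q))%:E * wmeas w Q)%E.
Proof.
move=> [w0 mw wQ _] rQ mf q0 hA hD; have mQ := measurable_rectangle rQ.
have mE (k : X -> R) : measurable_fun setT k -> measurable_fun Q (EFin \o k).
  by move=> mk; apply/measurable_EFinP; exact: measurable_funTS.
have mn e : measurable_fun setT (fun x => normc (f x - e) `^ q * w x).
  exact: (measurable_funM (measurableT_comp (measurable_powR q) (measurable_normc e mf)) mw).
pose u x : \bar R := (normc (f x - c) `^ q * w x)%:E.
have u0 x : (0 <= u x)%E by rewrite lee_fin mulr_ge0 ?powR_ge0.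
have mu_ : measurable_fun Q u := mE _ (mn c).
have mw' : measurable_fun Q (EFin \o w) := mE _ mw.
have w0' x : (0 <= (w x)%:E)%E by rewrite lee_fin.
apply: (@le_trans _ _ (\int[mu]_(x in Q) ((2 `^ q)%:E * (u x + (D `^ q)%:E * (w x)%:E)))%E).
  apply: ge0_le_integral.
  - exact: mQ.
  - by move=> x _; rewrite lee_fin mulr_ge0 ?powR_ge0.
  - exact: mE _ (mn d).
  - exact: (measurable_funeM _ (emeasurable_funD mu_ (measurable_funeM _ mw'))).
  move=> x _; rewrite -[leRHS]/((2 `^ q * (normc (f x - c) `^ q * w x + D `^ q * w x))%:E).
  rewrite lee_fin.
  rewrite -mulrDl mulrA ler_wpM2r //; apply: le_trans (le_powR_add _ _ _) => //.
  - apply: ge0_ler_powR; rewrite ?nnegrE ?normc_ge0 ?addr_ge0 ?(ltW q0) ?normc_ge0 //.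
      by rewrite (le_trans _ hD) ?normc_ge0.
    by rewrite (le_trans (le_normc_sub _ c _)) // lerD2l.
  - exact: normc_ge0.
  - by rewrite (le_trans _ hD) ?normc_ge0.
have mD : measurable_fun Q (fun x => (D `^ q)%:E * (w x)%:E)%E := measurable_funeM _ mw'.
have D0 x : Q x -> (0 <= (D `^ q)%:E * (w x)%:E)%E by rewrite mule_ge0 // lee_fin powR_ge0.
have uD0 x : Q x -> (0 <= u x + (D `^ q)%:E * (w x)%:E)%E.
  by move=> Qx; rewrite adde_ge0 // D0.
rewrite (ge0_integralZl_EFin mu mQ uD0 (emeasurable_funD mu_ mD) (powR_ge0 _ _)).
rewrite (ge0_integralD mu mQ (fun x _ => u0 x) mu_ D0 mD).
rewrite (ge0_integralZl_EFin mu mQ (fun x _ => w0' x) mw' (powR_ge0 _ _)) -/(wmeas w Q).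
have [W1 W2] := andP (wQ _ rQ).
have Wf : wmeas w Q \is a fin_num by rewrite ge0_fin_numE // ltW.
rewrite EFinM -muleA lee_wpmul2l ?lee_fin ?powR_ge0 //.
by rewrite EFinD muleDl // leeD2r.
Qed.

Lemma int_powR1 w f c Q :
  (\int[mu]_(x in Q) (normc (f x - c) `^ 1 * w x)%:E =
   \int[mu]_(x in Q) (normc (f x - c) * w x)%:E)%E.
Proof. by apply: eq_integral => x _; rewrite powRr1 // normc_ge0. Qed.

Lemma int_weight1 f c Q :
  (\int[mu]_(x in Q) (normc (f x - c) `^ 1 * 1)%:E =
   \int[mu]_(x in Q) (normc (f x - c))%:E)%E.
Proof. by apply: eq_integral => x _; rewrite mulr1 powRr1 // normc_ge0. Qed.

(** Chebyshev's inequality: an oscillation of order [q] gives the smallness of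
    level sets that [john_nirenberg] starts from, even for [q < 1]. *)
Lemma level_set_bound w f c q A lam Q : uniform_weight w -> rect Q -> cmeasurable f ->
  0 < q -> 0 < lam ->
  (\int[mu]_(x in Q) (normc (f x - c) `^ q * w x)%:E <= A%:E * wmeas w Q)%E ->
  (wmeas w (Q `&` [set x | (lam < normc (f x - c))%R]) <=
    (A / lam `^ q)%:E * wmeas w Q)%E.
Proof.
move=> [w0 mw wQ _] rQ mf q0 lam0 hA; have mQ := measurable_rectangle rQ.
pose m : {measure set X -> \bar R} := wmeasure w0 mw.
have mn : measurable_fun setT (fun x => normc (f x - c) `^ q).
  exact: (measurableT_comp (measurable_powR q) (measurable_normc c mf)).
have l0 : 0 < lam `^ q by rewrite powR_gt0.
have := weighted_chebyshev w0 mw mQ mn (fun x => powR_ge0 _ _) (ltW l0).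
move=> /le_trans /(_ hA) h.
rewrite mulrC EFinM -muleA lee_pdivlMl //; apply: le_trans h.
apply: lee_wpmul2l; first by rewrite lee_fin ltW.
apply: (@le_measure _ _ _ m); rewrite ?inE.
- by apply: measurableI => //; exact: measurable_normc_gt.
- apply: measurableI => //.
  have := measurable_fun_ler (measurable_cst (lam `^ q)) mn.
  by move=> /(_ measurableT [set true]); rewrite setTI; apply.
- move=> x [Qx /= h]; split => //=.
  by apply: ge0_ler_powR; rewrite ?nnegrE ?normc_ge0 ?(ltW q0) ?(ltW lam0) ?(ltW h).
Qed.

End oscillation.

(** * Comparison of the two norms *)

Section main.
Context (R : realType) (n1 n2 : nat).
Local Notation X := (euclid2 R n1 n2).
Local Notation mu := (lebesgue2 R n1 n2).
Local Notation rect := (rectangle R n1 n2).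
Implicit Types (w v : X -> R) (f : X -> R[i]).

Lemma bmo_norm_leP f N : (bmo_norm f <= N%:E)%E <->
  forall Q, rect Q ->
    (\int[mu]_(x in Q) (normc (f x - average f Q))%:E <= N%:E * mu Q)%E.
Proof.
have term Q (I : \bar R) : rect Q -> ((mu Q)^-1 * I <= N%:E)%E = (I <= N%:E * mu Q)%E.
  move=> rQ; have [r r0 muQ] := lebesgue2_rectangle rQ.
  by rewrite [mu Q]muQ inver gt_eqF // lee_pdivrMl // muleC.
split=> [hN Q rQ|h].
  by rewrite -term //; apply: le_trans hN; apply: ereal_sup_ubound; exists Q.
by apply: ge_ereal_sup => _ [Q rQ <-]; rewrite term //; exact: h.
Qed.

Lemma weighted_osc_leP p w v f M : uniform_weight w -> 0 < p -> 0 < M ->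
  (weighted_osc p w v f <= M%:E)%E <->
  forall Q, rect Q ->
    (\int[mu]_(x in Q) (normc (f x - wmean v f Q) `^ p * w x)%:E <=
      (M `^ p)%:E * wmeas w Q)%E.
Proof.
move=> [w0 _ wQ _] p0 M0.
suff term Q : rect Q ->
    (((wmeas w Q)^-1 * \int[mu]_(x in Q) (normc (f x - wmean v f Q) `^ p * w x)%:E)
      `^ p^-1 <= M%:E)%E <->
    (\int[mu]_(x in Q) (normc (f x - wmean v f Q) `^ p * w x)%:E <=
      (M `^ p)%:E * wmeas w Q)%E.
  split=> [hM Q rQ|h].
    by apply/(term _ rQ); apply: le_trans hM; apply: ereal_sup_ubound; exists Q.
  by apply: ge_ereal_sup => _ [Q rQ <-]; apply/(term _ rQ); exact: h.
move=> rQ; have [W1 W2] := andP (wQ _ rQ).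
have [W W0 ->] : exists2 W : R, 0 < W & wmeas w Q = W%:E.
  exists (fine (wmeas w Q)); first by rewrite fine_gt0 // W1 W2.
  by rewrite fineK // ge0_fin_numE // ltW.
have : (0 <= \int[mu]_(x in Q) (normc (f x - wmean v f Q) `^ p * w x)%:E)%E.
  by apply: integral_ge0 => x _; rewrite lee_fin mulr_ge0 ?powR_ge0.
rewrite inver gt_eqF //.
case: (\int[mu]_(x in Q) _)%E => [i i0||] //; last first.
  by move=> _; rewrite gt0_muley ?lte_fin ?invr_gt0 // poweRyr ?gt_eqF ?invr_gt0.
rewrite lee_fin in i0.
rewrite -[X in poweR X _]/((W^-1 * i)%:E) poweR_EFin -EFinM !lee_fin.
have Wi0 : 0 <= W^-1 * i by rewrite mulr_ge0 // invr_ge0 ltW.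
rewrite -ler_pdivrMr // [i / W]mulrC; split=> h.
  have -> : W^-1 * i = ((W^-1 * i) `^ p^-1) `^ p.
    by rewrite -powRrM mulVf ?gt_eqF // powRr1.
  by apply: ge0_ler_powR; rewrite ?nnegrE ?powR_ge0 ?(ltW p0) ?(ltW M0).
have -> : M = (M `^ p) `^ p^-1 by rewrite -powRrM mulfV ?gt_eqF // powRr1 // ltW.
by apply: ge0_ler_powR; rewrite ?nnegrE ?powR_ge0 ?invr_ge0 ?(ltW p0).
Qed.

Lemma wmeas_lty w Q r : uniform_weight w -> rect Q -> (r%:E * wmeas w Q < +oo)%E.
Proof.
move=> [_ _ wQ _] rQ; have [W1 W2] := andP (wQ _ rQ).
by rewrite -(@fineK _ (wmeas w Q)) ?ge0_fin_numE ?(ltW W1) // -EFinM ltry.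
Qed.

(** With [c Q] the mean of [f] over [Q], the John-Nirenberg estimates for [w] and
    for [v] control respectively the oscillation around [c Q] and the distance
    from [c Q] to the mean of [f] weighted by [v]. *)
Lemma bmo_weighted_osc p w v : uniform_weight w -> uniform_weight v -> 0 < p ->
  exists2 C : R, 0 < C & forall f N, cmeasurable f -> 0 < N -> (bmo_norm f <= N%:E)%E ->
    L1loc v f /\ (weighted_osc p w v f <= (C * N)%:E)%E.
Proof.
move=> uw uv p0.
have [C1 C10 hC1] := john_nirenberg_power uw p0.
have [C2 C20 hC2] := john_nirenberg_power uv ltr01.
set al := jn_density R n1 n2 in hC1 hC2.
have al0 : 0 < al := jn_density_gt0 R n1 n2.
pose B := C1 + (2 * C2) `^ p; have B0 : 0 < B by rewrite ltr_wpDr ?powR_ge0.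
exists (2 * B `^ p^-1 / al).
  by rewrite divr_gt0 // mulr_gt0 // powR_gt0.
move=> f N mf N0 /bmo_norm_leP hN.
pose lam := N / al; have lam0 : 0 < lam by rewrite divr_gt0.
have hlev Q : rect Q -> (mu (Q `&` [set x | (lam < normc (f x - average f Q))%R]) <=
    al%:E * mu Q)%E.
  move=> rQ; have mQ := measurable_rectangle rQ.
  have := @level_set_bound _ _ _ (fun=> 1) f (average f Q) 1 N lam Q
    (uniform_weight1 R n1 n2) rQ mf ltr01 lam0.
  rewrite int_weight1 !wmeas1 //; last first.
    by apply: measurableI => //; exact: measurable_normc_gt.
  move=> /(_ (hN _ rQ)); rewrite powRr1 ?(ltW lam0) // /lam invf_div mulrCA.
  by rewrite mulfV ?mulr1 ?gt_eqF.
have hw := hC1 f (average f) lam mf lam0 hlev.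
have hv := hC2 f (average f) lam mf lam0 hlev.
split.
  split=> // Q rQ.
  have := recenter (d := 0) uv rQ mf ltr01 (hv _ rQ) (lexx _).
  rewrite int_powR1; under eq_integral => x _ do rewrite subr0.
  by move=> /le_lt_trans; apply; exact: wmeas_lty.
apply/weighted_osc_leP => //; first by rewrite mulr_gt0 // divr_gt0 // mulr_gt0 // powR_gt0.
move=> Q rQ.
have hd : normc (average f Q - wmean v f Q) <= 2 * (C2 * lam).
  rewrite normc_distC; apply: wmean_close => //.
  by have := hv _ rQ; rewrite int_powR1 powRr1 // ltW.
apply: le_trans (recenter uw rQ mf p0 (hw _ rQ) hd) _.
have [_ _ wQ _] := uw; have [W1 _] := andP (wQ _ rQ).
rewrite lee_wpmul2r ?(ltW W1) // lee_fin le_eqVlt; apply/orP; left; apply/eqP.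
have -> : 2 * B `^ p^-1 / al * N = 2 * B `^ p^-1 * lam by rewrite /lam; ring.
have -> : (2 * (C2 * lam)) `^ p = (2 * C2) `^ p * lam `^ p.
  by rewrite mulrA powRM ?(ltW lam0) // mulr_ge0 // ltW.
have -> : (2 * B `^ p^-1 * lam) `^ p = 2 `^ p * B * lam `^ p.
  rewrite powRM ?(ltW lam0) ?mulr_ge0 ?powR_ge0 // (@powRM _ 2) ?powR_ge0 //.
  by rewrite -powRrM mulVf ?gt_eqF // powRr1 // ltW.
by rewrite /B; ring.
Qed.

(** With [c Q] the mean weighted by [v], Chebyshev's inequality makes the level
    sets small for [w], hence for Lebesgue measure since [w] is a uniform weight;
    the John-Nirenberg estimate is then used with the weight 1. *)
Lemma weighted_osc_bmo p w v : uniform_weight w -> 0 < p ->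
  exists2 C : R, 0 < C & forall f M, cmeasurable f -> 0 < M ->
    (weighted_osc p w v f <= M%:E)%E ->
    (forall Q, rect Q -> (\int[mu]_(x in Q) (normc (f x))%:E < +oo)%E) /\
    (bmo_norm f <= (C * M)%:E)%E.
Proof.
move=> uw p0; have u1 := uniform_weight1 R n1 n2.
have [C C0 hC] := john_nirenberg_power u1 ltr01.
set al := jn_density R n1 n2 in hC.
have al0 : 0 < al := jn_density_gt0 R n1 n2.
have [w0 mw wQ hw] := uw; have [eta eta0 heta] := hw _ al0.
(* chosen so that level sets have [w]-proportion [eta / 2], less than [eta] *)
pose ka := (2 / eta) `^ p^-1; have ka0 : 0 < ka by rewrite powR_gt0 // divr_gt0.
exists (6 * C * ka); first by rewrite !mulr_gt0.
move=> f M mf M0 /(weighted_osc_leP _ _ uw p0 M0) hM.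
pose lam := M * ka; have lam0 : 0 < lam by rewrite mulr_gt0.
have hlev Q : rect Q -> (mu (Q `&` [set x | (lam < normc (f x - wmean v f Q))%R]) <=
    al%:E * mu Q)%E.
  move=> rQ; have mQ := measurable_rectangle rQ.
  set G := Q `&` _.
  have mG : measurable G by apply: measurableI => //; exact: measurable_normc_gt.
  have := level_set_bound uw rQ mf p0 lam0 (hM _ rQ); rewrite -/G.
  have -> : M `^ p / lam `^ p = eta / 2.
    rewrite /lam powRM ?(ltW M0) ?(ltW ka0) // -powRrM mulVf ?gt_eqF //.
    rewrite powRr1 ?divr_ge0 ?(ltW eta0) //.
    by field; rewrite !gt_eqF ?powR_gt0.
  move=> hG; rewrite leNgt; apply/negP => /ltW /(heta _ _ rQ mG (@subIsetl _ _ _)).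
  move=> /le_trans /(_ hG); have [W1 W2] := andP (wQ _ rQ).
  rewrite -(@fineK _ (wmeas w Q)) ?ge0_fin_numE ?(ltW W1) // -!EFinM lee_fin.
  rewrite ler_pM2r ?fine_gt0 ?W1 ?W2 // leNgt ltr_pdivrMr // ltr_pMr //.
  by rewrite ltr1n.
have h := hC f (wmean v f) lam mf lam0 hlev.
split.
  move=> Q rQ; have := recenter (d := 0) u1 rQ mf ltr01 (h _ rQ) (lexx _).
  rewrite int_weight1; under eq_integral => x _ do rewrite subr0.
  by move=> /le_lt_trans; apply; exact: wmeas_lty.
apply/bmo_norm_leP => Q rQ; have mQ := measurable_rectangle rQ.
have hd : normc (wmean v f Q - average f Q) <= 2 * (C * lam).
  rewrite normc_distC average_wmean //; apply: wmean_close => //.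
  by have := h _ rQ; rewrite int_powR1 powRr1 // ltW.
have := recenter u1 rQ mf ltr01 (h _ rQ) hd.
have CL0 : 0 <= 2 * (C * lam) by apply: mulr_ge0 => //; apply/ltW/mulr_gt0.
rewrite int_weight1 wmeas1 // (powRr1 (ltW lam0)) (powRr1 CL0) powRr1 //.
by have -> : 2 * (C * lam + 2 * (C * lam)) = 6 * C * ka * M by rewrite /lam; ring.
Qed.

Lemma bmo_norm_ge0 f : (0 <= bmo_norm f)%E.
Proof.
apply: ereal_sup_ge; have rQ := rectangle_big_rectangle R n1 n2 0.
eexists; first by exists (@big_rectangle R n1 n2 0).
by rewrite mule_ge0 ?inve_ge0 // integral_ge0 // => x _; rewrite lee_fin normc_ge0.
Qed.

Lemma weighted_osc_ge0 p w v f : (0 <= weighted_osc p w v f)%E.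
Proof.
apply: ereal_sup_ge; have rQ := rectangle_big_rectangle R n1 n2 0.
eexists; first by exists (@big_rectangle R n1 n2 0).
exact: poweR_ge0.
Qed.

End main.

Lemma le_of_real_bounds (R : realType) (C : R) (x y : \bar R) : 0 < C -> (0 <= y)%E ->
  (forall N : R, 0 < N -> (y <= N%:E)%E -> (x <= (C * N)%:E)%E) -> (x <= C%:E * y)%E.
Proof.
move=> C0; case: y => [y|_ _|//]; last by rewrite gt0_muley ?lte_fin // leey.
rewrite lee_fin => y0 h; apply/lee_addgt0Pr => e e0.
have eC0 : 0 < e / C by rewrite divr_gt0.
have := h (y + e / C); rewrite mulrDr [C * (e / C)]mulrC divfK ?gt_eqF // EFinD EFinM.
by apply; [rewrite ltr_wpDl|rewrite lee_fin lerDl ltW].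
Qed.

Lemma real_bound_of_lty (R : realType) (y : \bar R) : (y < +oo)%E ->
  exists2 N : R, 0 < N & (y <= N%:E)%E.
Proof.
case: y => [y _|//|_]; last by exists 1; rewrite ?leNye.
exists (`|y| + 1); first by rewrite ltr_wpDl.
by rewrite lee_fin (le_trans (ler_norm y)) // lerDl.
Qed.

Theorem theorem5p14 (R : realType) (n1 n2 : nat)
    (n1_gt0 : (0 < n1)%N) (n2_gt0 : (0 < n2)%N)
    (p : R) (p_gt0 : 0 < p) (w v : euclid2 R n1 n2 -> R)
    (wA : Ainfty w) (vA : Ainfty v) :
  (forall f : euclid2 R n1 n2 -> R[i],
     (L1loc v f /\ (weighted_osc p w v f < +oo)%E) <-> bmo f) /\
  (exists C : R, 0 < C /\
     forall f : euclid2 R n1 n2 -> R[i], bmo f ->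
       (bmo_norm f <= C%:E * weighted_osc p w v f)%E /\
       (weighted_osc p w v f <= C%:E * bmo_norm f)%E).
Proof.
have uw := Ainfty_uniform wA; have uv := Ainfty_uniform vA.
have [C1 C10 h1] := bmo_weighted_osc uw uv p_gt0.
have [C2 C20 h2] := weighted_osc_bmo v uw p_gt0.
split.
  move=> f; split=> [[[mf _] /real_bound_of_lty[M M0 hM]]|[mf _ /real_bound_of_lty[N N0 hN]]].
    have [loc hb] := h2 f M mf M0 hM; split => //.
    by apply: le_lt_trans hb _; rewrite ltry.
  have [loc hb] := h1 f N mf N0 hN; split => //.
  by apply: le_lt_trans hb _; rewrite ltry.
have C0 : 0 < C1 + C2 by rewrite addr_gt0.
exists (C1 + C2); split => // f [mf _ _]; split.
- apply: le_of_real_bounds => //; first exact: weighted_osc_ge0.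
  move=> M M0 hM; apply: le_trans (h2 f M mf M0 hM).2 _.
  by rewrite lee_fin ler_pM2r // lerDr ltW.
- apply: le_of_real_bounds => //; first exact: bmo_norm_ge0.
  move=> N N0 hN; apply: le_trans (h1 f N mf N0 hN).2 _.
  by rewrite lee_fin ler_pM2r // lerDl ltW.
Qed.
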